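(* Let $k$ be an algebraically closed field and let $\mathcal{C}$ be a pivotal finite tensor category over $k$. Then there exists a non-zero two-sided modified trace on $\mathrm{Proj}(\mathcal{C})$ if and only if $\mathcal{C}$ is spherical. If this is the case, a non-zero two-sided modified trace on $\mathrm{Proj}(\mathcal{C})$ is unique up to scalar multiple and every such trace is non-degenerate.
   Context: A finite abelian category is a $k$-linear category equivalent to the category of finite-dimensional left modules over a finite-dimensional $k$-algebra. A finite tensor category is a finite abelian category $\mathcal{C}$ that is a rigid monoidal category (assumed strict) with $k$-bilinear tensor product and simple unit object $\mathbb{1}$. $\mathrm{Proj}(\mathcal{C})$ is the full subcategory of projective objects. $X^*$ is the left dual of $X$ with $\mathrm{ev}_X:X^*\otimes X\to\mathbb{1}$, $\mathrm{coev}_X:\mathbb{1}\to X\otimes X^*$; ${}^*X$ is the right dual with $\mathrm{ev}'_X:X\otimes{}^*X\to\mathbb{1}$, $\mathrm{coev}'_X:\mathbb{1}\to{}^*X\otimes X$. The duality functors are assumed strict monoidal and mutually inverse. A pivotal structure is an isomorphism $\mathfrak{p}:\mathrm{id}_{\mathcal{C}}\to(-)^{**}$ of monoidal functors; pivotal means equipped with one. Closing operators: for $f:M\otimes X\to N\otimes X^{**}$ put $\mathrm{cl}^r_{M,N|X}(f)=(\mathrm{id}_N\otimes\mathrm{ev}_{X^*})(f\otimes\mathrm{id}_{X^*})(\mathrm{id}_M\otimes\mathrm{coev}_X):M\to N$; for $f:X\otimes M\to{}^{**}X\otimes N$ put $\mathrm{cl}^l_{X|M,N}(f)=(\mathrm{ev}'_{{}^*X}\otimes\mathrm{id}_N)(\mathrm{id}_{{}^*X}\otimes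 f)(\mathrm{coev}'_X\otimes\mathrm{id}_M):M\to N$. A two-sided modified trace on $\mathrm{Proj}(\mathcal{C})$ is a family of $k$-linear maps $\mathtt{t}_P:\mathrm{Hom}_{\mathcal{C}}(P,P)\to k$ ($P$ projective) with $\mathtt{t}_P(gf)=\mathtt{t}_Q(fg)$ for all $f:P\to Q$, $g:Q\to P$ between projectives, and, for all projective $P$ and all $X\in\mathcal{C}$: (right) $\mathtt{t}_P(\mathrm{cl}^r_{P,P|X}(f))=\mathtt{t}_{P\otimes X}((\mathrm{id}_P\otimes\mathfrak{p}_X^{-1})f)$ for all $f:P\otimes X\to P\otimes X^{**}$; (left) $\mathtt{t}_P(\mathrm{cl}^l_{X|P,P}(f))=\mathtt{t}_{X\otimes P}((\mathfrak{p}_{{}^{**}X}\otimes\mathrm{id}_P)f)$ for all $f:X\otimes P\to{}^{**}X\otimes P$. It is non-degenerate if $\mathrm{Hom}_{\mathcal{C}}(M,P)\times\mathrm{Hom}_{\mathcal{C}}(P,M)\to k$, $(f,g)\mapsto\mathtt{t}_P(fg)$, is non-degenerate for all $M\in\mathcal{C}$ and projective $P$. Nakayama functor: for finite-dimensional $V$ and $M\in\mathcal{C}$, $V\cdot M$ is defined by $\mathrm{Hom}_{\mathcal{C}}(V\cdot M,N)\cong\mathrm{Hom}_k(V,\mathrm{Hom}_{\mathcal{C}}(M,N))$; $\mathbb{N}(M)=\int^{Z\in\mathcal{C}}\mathrm{Hom}_{\mathcal{C}}(M,Z)^*\cdot Z$ with universal dinatural transformation $\mathbb{i}_{Z,M}$.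 It has canonical isomorphisms $\Psi^{\mathbb{N}}_{M,X}:\mathbb{N}(M)\otimes X^{**}\to\mathbb{N}(M\otimes X)$ and $\Phi^{\mathbb{N}}_{X,M}:{}^{**}X\otimes\mathbb{N}(M)\to\mathbb{N}(X\otimes M)$, uniquely determined by requiring, for all $Z$ and up to the canonical isomorphisms $(V\cdot Z)\otimes X^{**}\cong V\cdot(Z\otimes X^{**})$ and ${}^{**}X\otimes(V\cdot Z)\cong V\cdot({}^{**}X\otimes Z)$: $\Psi^{\mathbb{N}}_{M,X}\circ(\mathbb{i}_{Z,M}\otimes\mathrm{id}_{X^{**}})=\mathbb{i}_{Z\otimes X^{**},M\otimes X}\circ((\mathrm{cl}^r_{M,Z|X})^*\cdot\mathrm{id})$ and $\Phi^{\mathbb{N}}_{X,M}\circ(\mathrm{id}_{{}^{**}X}\otimes\mathbb{i}_{Z,M})=\mathbb{i}_{{}^{**}X\otimes Z,X\otimes M}\circ((\mathrm{cl}^l_{X|M,Z})^*\cdot\mathrm{id})$. Put $\alpha_{\mathcal{C}}=\mathbb{N}(\mathbb{1})$; $\mathcal{C}$ is unimodular if $\alpha_{\mathcal{C}}\cong\mathbb{1}$. The Radford isomorphism is $g_X=(\Psi^{\mathbb{N}}_{\mathbb{1},X})^{-1}\circ\Phi^{\mathbb{N}}_{X,\mathbb{1}}:{}^{**}X\otimes\alpha_{\mathcal{C}}\to\alpha_{\mathcal{C}}\otimes X^{**}$. $\mathcal{C}$ is spherical if it is unimodular and, for an (equivalently any) isomorphism $f:\mathbb{1}\to\alpha_{\mathcal{C}}$,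 $g_X\circ(\mathrm{id}_{{}^{**}X}\otimes f)=(f\otimes\mathrm{id}_{X^{**}})\circ\mathfrak{p}_X\circ\mathfrak{p}_{{}^{**}X}$ for all $X\in\mathcal{C}$. *)

(* Defs.v *)
From HB Require Import structures.
From mathcomp Require Import all_boot all_algebra falgebra.
From mathcomp Require Import boolp.

Set Implicit Arguments.
Unset Strict Implicit.
Unset Printing Implicit Defensive.

Import GRing.Theory.
Local Open Scope ring_scope.

Lemma linfun_linE (k : fieldType) (U V : vectType k) (f : U -> V) :
  linear f -> linfun f =1 f.
Proof.
move=> L; pose LM := GRing.isLinear.Build _ _ _ _ _ L.
pose F : {linear U -> V} := HB.pack f LM.
exact: (lfunE F).
Qed.

Declare Scope cat_scope.
Delimit Scope cat_scope with cat.

(* A finite abelian category has finite-dimensional Hom-spaces, so these are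
   taken in [vectType k] from the start. *)

Record lincat (k : fieldType) := LinCat {
  obj :> Type;
  Hom : obj -> obj -> vectType k;
  idm : forall X, Hom X X;
  comp : forall X Y Z, Hom Y Z -> Hom X Y -> Hom X Z;
  compA : forall X Y Z W (h : Hom Z W) (g : Hom Y Z) (f : Hom X Y),
    comp h (comp g f) = comp (comp h g) f;
  comp1m : forall X Y (f : Hom X Y), comp (idm Y) f = f;
  compm1 : forall X Y (f : Hom X Y), comp f (idm X) = f;
  comp_linr : forall X Y Z (g : Hom Y Z), linear (fun f : Hom X Y => comp g f);
  comp_linl : forall X Y Z (f : Hom X Y), linear (fun g : Hom Y Z => comp g f)
}.
Arguments Hom {k l}.
Arguments idm {k l} X.
Arguments comp {k l X Y Z}.

Notation "g \o f" := (comp g f) : cat_scope.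
Local Open Scope cat_scope.

Section LinCat.
Variables (k : fieldType) (C : lincat k).
Implicit Types X Y Z : C.

Definition is_iso X Y (f : Hom X Y) : Prop :=
  exists g : Hom Y X, g \o f = idm X /\ f \o g = idm Y.
Definition isomorphic X Y : Prop := exists f : Hom X Y, is_iso f.
Definition is_mono X Y (f : Hom X Y) : Prop :=
  forall Z (g h : Hom Z X), f \o g = f \o h -> g = h.
Definition is_epi X Y (f : Hom X Y) : Prop :=
  forall Z (g h : Hom Y Z), g \o f = h \o f -> g = h.
Definition is_zero_obj X : Prop := idm X = 0.
Definition simple_obj X : Prop :=
  ~ is_zero_obj X /\
  forall U (i : Hom U X), is_mono i -> is_zero_obj U \/ is_iso i.
Definition projective X : Prop :=
  forall Y Z (e : Hom Y Z) (f : Hom X Z), is_epi e ->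
    exists g : Hom X Y, e \o g = f.

Definition eqhom X Y (e : X = Y) : Hom X Y :=
  match e in _ = Y' return Hom X Y' with erefl => idm X end.

Definition postcomp X Y Z (g : Hom Y Z) : 'Hom(Hom X Y, Hom X Z) :=
  linfun (fun f : Hom X Y => g \o f).
Definition precomp X Y Z (f : Hom X Y) : 'Hom(Hom Y Z, Hom X Z) :=
  linfun (fun g : Hom Y Z => g \o f).

End LinCat.

Record linfunctor (k : fieldType) (C D : lincat k) := LinFunctor {
  fobj :> C -> D;
  fmor : forall X Y, 'Hom(Hom X Y, Hom (fobj X) (fobj Y));
  fmor_id : forall X, fmor X X (idm X) = idm (fobj X);
  fmor_comp : forall X Y Z (g : Hom Y Z) (f : Hom X Y),
    fmor X Z (g \o f) = fmor Y Z g \o fmor X Y f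
}.
Arguments fmor {k C D} l {X Y}.

Section Functors.
Variable k : fieldType.

Program Definition functor_id (C : lincat k) : linfunctor C C :=
  @LinFunctor k C C (fun X => X) (fun X Y => \1%VF) _ _.
Next Obligation. by rewrite id_lfunE. Qed.
Next Obligation. by rewrite !id_lfunE. Qed.

Program Definition functor_comp (C D E : lincat k)
    (G : linfunctor D E) (F : linfunctor C D) : linfunctor C E :=
  @LinFunctor k C E (fun X => G (F X)) (fun X Y => (fmor G \o fmor F)%VF) _ _.
Next Obligation. by rewrite comp_lfunE !fmor_id. Qed.
Next Obligation. by rewrite !comp_lfunE !fmor_comp. Qed.

Definition nat_isomorphic (C D : lincat k) (F G : linfunctor C D) : Prop :=
  exists a : forall X, Hom (F X) (G X),
    (forall X, is_iso (a X)) /\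
    (forall X Y (f : Hom X Y), a Y \o fmor F f = fmor G f \o a X).

Definition equivalent (C D : lincat k) : Prop :=
  exists (F : linfunctor C D) (G : linfunctor D C),
    nat_isomorphic (functor_comp G F) (functor_id C) /\
    nat_isomorphic (functor_comp F G) (functor_id D).

End Functors.

Record fdmod (k : fieldType) (A : falgType k) := FdMod {
  mcar :> vectType k;
  mact : 'Hom(A, 'Hom(mcar, mcar));
  mact1 : mact 1 = \1%VF;
  mactM : forall a b : A, mact (a * b) = (mact a \o mact b)%VF
}.
Arguments mact {k A} f.

Section Modules.
Variables (k : fieldType) (A : falgType k).
Implicit Types U V W : fdmod A.

Definition mcomm_fun V W (f : 'Hom(V, W)) : 'Hom(A, 'Hom(V, W)) :=
  linfun (fun a : A => (f \o mact V a)%VF - (mact W a \o f)%VF).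

Definition mhom V W : {vspace 'Hom(V, W)} := lker (linfun (@mcomm_fun V W)).

Lemma mcomm_funE V W (f : 'Hom(V, W)) (a : A) :
  mcomm_fun f a = (f \o mact V a)%VF - (mact W a \o f)%VF.
Proof.
apply: linfun_linE => {a} c a b; rewrite !linearP /= comp_lfunDl comp_lfunDr.
by rewrite -comp_lfunZl -comp_lfunZr scalerBr opprD addrACA.
Qed.

Lemma mhomP V W (f : 'Hom(V, W)) :
  reflect (forall (a : A) (v : V), f (mact V a v) = mact W a (f v))
          (f \in mhom V W).
Proof.
have L : linear (@mcomm_fun V W).
  move=> c x y; apply/lfunP => a; rewrite add_lfunE scale_lfunE !mcomm_funE.
  rewrite comp_lfunDl comp_lfunDr -comp_lfunZl -comp_lfunZr.
  by rewrite scalerBr opprD addrACA.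
rewrite /mhom memv_ker (linfun_linE L).
apply: (iffP eqP) => [/lfunP f0 a v | fP].
  move: (f0 a); rewrite mcomm_funE zero_lfunE => /eqP; rewrite subr_eq0.
  by move=> /eqP/lfunP/(_ v); rewrite !comp_lfunE.
apply/lfunP => a; rewrite mcomm_funE zero_lfunE; apply/eqP.
by rewrite subr_eq0; apply/eqP/lfunP => v; rewrite !comp_lfunE fP.
Qed.

Definition mhom_id V : subvs_of (mhom V V) := vsproj (mhom V V) \1%VF.
Definition mhom_comp U V W (g : subvs_of (mhom V W)) (f : subvs_of (mhom U V)) :
  subvs_of (mhom U W) := vsproj (mhom U W) (vsval g \o vsval f)%VF.

Lemma mhom_idE V : vsval (mhom_id V) = \1%VF.
Proof. by apply: vsprojK; apply/mhomP => a v; rewrite !id_lfunE. Qed.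

Lemma mhom_compE U V W (g : subvs_of (mhom V W)) (f : subvs_of (mhom U V)) :
  vsval (mhom_comp g f) = (vsval g \o vsval f)%VF.
Proof.
apply: vsprojK; apply/mhomP => a v; rewrite !comp_lfunE.
by rewrite (mhomP _ (subvsP f)) (mhomP _ (subvsP g)).
Qed.

Program Definition modcat : lincat k :=
  @LinCat k (fdmod A) (fun V W => subvs_of (mhom V W)) mhom_id mhom_comp
    _ _ _ _ _.
Next Obligation.
by apply: val_inj; rewrite /= !mhom_compE comp_lfunA.
Qed.
Next Obligation.
by apply: val_inj; rewrite /= mhom_compE mhom_idE comp_lfun1l.
Qed.
Next Obligation.
by apply: val_inj; rewrite /= mhom_compE mhom_idE comp_lfun1r.
Qed.
Next Obligation.
move=> c f f'; apply: val_inj.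
rewrite -[LHS]/(vsval _) -[RHS]/(vsval _) [RHS]linearP /= !mhom_compE.
by rewrite linearP /= comp_lfunDr -comp_lfunZr.
Qed.
Next Obligation.
move=> c g g'; apply: val_inj.
rewrite -[LHS]/(vsval _) -[RHS]/(vsval _) [RHS]linearP /= !mhom_compE.
by rewrite linearP /= comp_lfunDl -comp_lfunZl.
Qed.

End Modules.

Definition finite_abelian (k : fieldType) (C : lincat k) : Prop :=
  exists A : falgType k, equivalent C (modcat A).

(* Strict monoidal: strictness is an equality of objects, and morphisms are
   compared along [eqhom]; by proof irrelevance the choice of equality proofs
   is immaterial and no coherence axiom is needed. *)

Record smcat (k : fieldType) := SMCat {
  sm_cat :> lincat k;
  tens : sm_cat -> sm_cat -> sm_cat;
  tensm : forall X X' Y Y' : sm_cat,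
    Hom X X' -> Hom Y Y' -> Hom (tens X Y) (tens X' Y');
  one : sm_cat;
  tensm_id : forall X Y : sm_cat, tensm (idm X) (idm Y) = idm (tens X Y);
  tensm_comp : forall (X X' X'' Y Y' Y'' : sm_cat)
    (f' : Hom X' X'') (f : Hom X X') (g' : Hom Y' Y'') (g : Hom Y Y'),
    tensm (f' \o f) (g' \o g) = tensm f' g' \o tensm f g;
  tensm_linr : forall (X X' Y Y' : sm_cat) (f : Hom X X'),
    linear (fun g : Hom Y Y' => tensm f g);
  tensm_linl : forall (X X' Y Y' : sm_cat) (g : Hom Y Y'),
    linear (fun f : Hom X X' => tensm f g);
  tensA : forall X Y Z : sm_cat, tens (tens X Y) Z = tens X (tens Y Z);
  tens1o : forall X : sm_cat, tens one X = X;
  tenso1 : forall X : sm_cat, tens X one = X;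
  tensmA : forall (X X' Y Y' Z Z' : sm_cat)
    (f : Hom X X') (g : Hom Y Y') (h : Hom Z Z'),
    eqhom (tensA X' Y' Z') \o tensm (tensm f g) h =
    tensm f (tensm g h) \o eqhom (tensA X Y Z);
  tensm1l : forall (X X' : sm_cat) (f : Hom X X'),
    eqhom (tens1o X') \o tensm (idm one) f = f \o eqhom (tens1o X);
  tensm1r : forall (X X' : sm_cat) (f : Hom X X'),
    eqhom (tenso1 X') \o tensm f (idm one) = f \o eqhom (tenso1 X)
}.
Arguments tens {k s}.
Arguments tensm {k s X X' Y Y'}.
Arguments one {k s}.

Notation "X ⊗ Y" := (tens X Y) (at level 40, left associativity) : cat_scope.
Notation "f ⊗₁ g" := (tensm f g) (at level 38, left associativity) : cat_scope.

Section Structural.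
Variables (k : fieldType) (C : smcat k).
Implicit Types X Y Z : C.

Definition asc X Y Z : Hom ((X ⊗ Y) ⊗ Z) (X ⊗ (Y ⊗ Z)) := eqhom (tensA X Y Z).
Definition ascV X Y Z : Hom (X ⊗ (Y ⊗ Z)) ((X ⊗ Y) ⊗ Z) :=
  eqhom (esym (tensA X Y Z)).
Definition lun X : Hom (one ⊗ X) X := eqhom (tens1o X).
Definition lunV X : Hom X (one ⊗ X) := eqhom (esym (tens1o X)).
Definition run X : Hom (X ⊗ one) X := eqhom (tenso1 X).
Definition runV X : Hom X (X ⊗ one) := eqhom (esym (tenso1 X)).

End Structural.

Record rigid (k : fieldType) (C : smcat k) := Rigid {
  ld : C -> C;
  ev : forall X : C, Hom (ld X ⊗ X) one;
  coev : forall X : C, Hom one (X ⊗ ld X);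
  ev_coev : forall X : C,
    run X \o (idm X ⊗₁ ev X) \o asc X (ld X) X \o (coev X ⊗₁ idm X) \o lunV X
    = idm X;
  coev_ev : forall X : C,
    lun (ld X) \o (ev X ⊗₁ idm (ld X)) \o ascV (ld X) X (ld X)
      \o (idm (ld X) ⊗₁ coev X) \o runV (ld X)
    = idm (ld X);
  rd : C -> C;
  ev' : forall X : C, Hom (X ⊗ rd X) one;
  coev' : forall X : C, Hom one (rd X ⊗ X);
  ev_coev' : forall X : C,
    lun X \o (ev' X ⊗₁ idm X) \o ascV X (rd X) X \o (idm X ⊗₁ coev' X) \o runV X
    = idm X;
  coev_ev' : forall X : C,
    run (rd X) \o (idm (rd X) ⊗₁ ev' X) \o asc (rd X) X (rd X)
      \o (coev' X ⊗₁ idm (rd X)) \o lunV (rd X)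
    = idm (rd X)
}.

Section DualMorphisms.
Variables (k : fieldType) (C : smcat k) (D : rigid C).

Definition ldm (X Y : C) (f : Hom X Y) : Hom (ld D Y) (ld D X) :=
  lun (ld D X) \o ((ev D Y \o (idm (ld D Y) ⊗₁ f)) ⊗₁ idm (ld D X))
    \o ascV (ld D Y) X (ld D X) \o (idm (ld D Y) ⊗₁ coev D X) \o runV (ld D Y).

Definition rdm (X Y : C) (f : Hom X Y) : Hom (rd D Y) (rd D X) :=
  run (rd D X) \o (idm (rd D X) ⊗₁ (ev' D Y \o (f ⊗₁ idm (rd D Y))))
    \o asc (rd D X) X (rd D Y) \o (coev' D X ⊗₁ idm (rd D Y)) \o lunV (rd D Y).

(* The duality functors are strict monoidal and mutually inverse.  That the
   canonical isomorphism Y^* ⊗ X^* -> (X ⊗ Y)^* is an identity is expressed by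
   the formula for [ev] that characterizes it, and similarly for the unit and
   for right duals. *)
Record strict_duality : Prop := StrictDuality {
  ld_tens : forall X Y : C, ld D Y ⊗ ld D X = ld D (X ⊗ Y);
  ev_tens : forall X Y : C,
    ev D (X ⊗ Y) \o (eqhom (ld_tens X Y) ⊗₁ idm (X ⊗ Y)) =
    ev D Y
      \o (idm (ld D Y)
            ⊗₁ (lun Y \o (ev D X ⊗₁ idm Y) \o ascV (ld D X) X Y))
      \o asc (ld D Y) (ld D X) (X ⊗ Y);
  ld_one : one = ld D one;
  ev_one : ev D one \o (eqhom ld_one ⊗₁ idm one) = lun one;
  rd_tens : forall X Y : C, rd D Y ⊗ rd D X = rd D (X ⊗ Y);
  ev'_tens : forall X Y : C,
    ev' D (X ⊗ Y) \o (idm (X ⊗ Y) ⊗₁ eqhom (rd_tens X Y)) =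
    ev' D X
      \o ((run X \o (idm X ⊗₁ ev' D Y) \o asc X Y (rd D Y))
            ⊗₁ idm (rd D X))
      \o ascV (X ⊗ Y) (rd D Y) (rd D X);
  rd_one : one = rd D one;
  ev'_one : ev' D one \o (idm one ⊗₁ eqhom rd_one) = run one;
  rd_ld : forall X : C, rd D (ld D X) = X;
  rdm_ldm : forall (X Y : C) (f : Hom X Y),
    eqhom (rd_ld Y) \o rdm (ldm f) = f \o eqhom (rd_ld X);
  ld_rd : forall X : C, ld D (rd D X) = X;
  ldm_rdm : forall (X Y : C) (f : Hom X Y),
    eqhom (ld_rd Y) \o ldm (rdm f) = f \o eqhom (ld_rd X)
}.

End DualMorphisms.

Record ftcat (k : fieldType) := FTCat {
  ft_sm :> smcat k;
  ft_rigid : rigid ft_sm;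
  ft_strict : strict_duality ft_rigid;
  ft_finite : finite_abelian ft_sm;
  ft_unit : simple_obj (one : ft_sm)
}.

(* X ^L is the left dual and X ^R the right dual. *)
Notation "X '^L'" := (ld (ft_rigid _) X)
  (at level 2, left associativity, format "X ^L") : cat_scope.
Notation "X '^LL'" := (ld (ft_rigid _) (ld (ft_rigid _) X))
  (at level 2, left associativity, format "X ^LL") : cat_scope.
Notation "X '^R'" := (rd (ft_rigid _) X)
  (at level 2, left associativity, format "X ^R") : cat_scope.
Notation "X '^RR'" := (rd (ft_rigid _) (rd (ft_rigid _) X))
  (at level 2, left associativity, format "X ^RR") : cat_scope.

Section FiniteTensor.
Variables (k : fieldType) (C : ftcat k).
Implicit Types X Y M N : C.

Notation ev := (ev (ft_rigid C)).
Notation coev := (coev (ft_rigid C)).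
Notation ev' := (ev' (ft_rigid C)).
Notation coev' := (coev' (ft_rigid C)).

Definition ddm X Y (f : Hom X Y) : Hom X^LL Y^LL :=
  ldm (ft_rigid C) (ldm (ft_rigid C) f).

Lemma dd_tens X Y : X^LL ⊗ Y^LL = (X ⊗ Y)^LL.
Proof. by rewrite -(ld_tens (ft_strict C)) (ld_tens (ft_strict C)). Qed.

Lemma dd_one : one = (one : C)^LL.
Proof. by rewrite -!(ld_one (ft_strict C)). Qed.

Lemma ld_ld_rd_rd X : X^RR^LL = X.
Proof. by rewrite !(ld_rd (ft_strict C)). Qed.

Record pivotal := Pivotal {
  piv : forall X : C, Hom X X^LL;
  pivV : forall X : C, Hom X^LL X;
  pivK : forall X : C, pivV X \o piv X = idm X;
  pivVK : forall X : C, piv X \o pivV X = idm X^LL;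
  piv_nat : forall (X Y : C) (f : Hom X Y), ddm f \o piv X = piv Y \o f;
  piv_tens : forall X Y : C,
    piv (X ⊗ Y) = eqhom (dd_tens X Y) \o (piv X ⊗₁ piv Y);
  piv_one : piv one = eqhom dd_one
}.

(* p_{**X} : **X -> X *)
Definition pivrr (p : pivotal) X : Hom X^RR X :=
  eqhom (ld_ld_rd_rd X) \o piv p X^RR.

Definition clr M N X (f : Hom (M ⊗ X) (N ⊗ X^LL)) : Hom M N :=
  run N \o (idm N ⊗₁ ev X^L) \o asc N X^LL X^L
    \o (f ⊗₁ idm X^L)
    \o ascV M X X^L \o (idm M ⊗₁ coev X) \o runV M.

Definition cll X M N (f : Hom (X ⊗ M) (X^RR ⊗ N)) : Hom M N :=
  lun N \o (ev' X^R ⊗₁ idm N) \o ascV X^R X^RR N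
    \o (idm X^R ⊗₁ f)
    \o asc X^R X M \o (coev' X ⊗₁ idm M) \o lunV M.

End FiniteTensor.

Section EqHom.
Variables (k : fieldType) (C : lincat k).

Lemma eqhom_comp (X Y Z : C) (e : X = Y) (e' : Y = Z) :
  eqhom e' \o eqhom e = eqhom (etrans e e').
Proof. by case: Z / e'; rewrite comp1m. Qed.

Lemma eqhom_irr (X Y : C) (e e' : X = Y) : eqhom e = eqhom e'.
Proof. by rewrite (Prop_irrelevance e e'). Qed.

Lemma eqhom_id (X : C) (e : X = X) : eqhom e = idm X.
Proof. exact: (eqhom_irr e erefl). Qed.

End EqHom.

Section ProjectiveTensor.
Variables (k : fieldType) (C : smcat k).
Implicit Types X Y Z M N : C.

Lemma eqhom_tens X X' Y Y' (e : X = X') (e' : Y = Y') :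
  eqhom e ⊗₁ eqhom e' = eqhom (f_equal2 tens e e').
Proof.
move: (f_equal2 _ _ _); destruct e, e' => e; rewrite (eqhom_id e).
exact: (tensm_id X Y).
Qed.

Lemma tensm_split X X' Y Y' (f : Hom X X') (g : Hom Y Y') :
  (f ⊗₁ idm Y') \o (idm X ⊗₁ g) = f ⊗₁ g.
Proof. by rewrite -tensm_comp compm1 comp1m. Qed.

Lemma tensm_split' X X' Y Y' (f : Hom X X') (g : Hom Y Y') :
  (idm X' ⊗₁ g) \o (f ⊗₁ idm Y) = f ⊗₁ g.
Proof. by rewrite -tensm_comp compm1 comp1m. Qed.

Lemma compl_tensm X X' X'' (f' : Hom X' X'') (f : Hom X X') Y :
  (f' \o f) ⊗₁ idm Y = (f' ⊗₁ idm Y) \o (f ⊗₁ idm Y).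
Proof. by rewrite -tensm_comp comp1m. Qed.

Lemma compr_tensm X X' X'' (f' : Hom X' X'') (f : Hom X X') Y :
  idm Y ⊗₁ (f' \o f) = (idm Y ⊗₁ f') \o (idm Y ⊗₁ f).
Proof. by rewrite -tensm_comp comp1m. Qed.

Lemma asc_ascV X Y Z : asc X Y Z \o ascV X Y Z = idm _.
Proof. by rewrite /asc /ascV eqhom_comp eqhom_id. Qed.
Lemma ascV_asc X Y Z : ascV X Y Z \o asc X Y Z = idm _.
Proof. by rewrite /asc /ascV eqhom_comp eqhom_id. Qed.
Lemma run_runV X : run X \o runV X = idm _.
Proof. by rewrite /run /runV eqhom_comp eqhom_id. Qed.
Lemma runV_run X : runV X \o run X = idm _.
Proof. by rewrite /run /runV eqhom_comp eqhom_id. Qed.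
Lemma lun_lunV X : lun X \o lunV X = idm _.
Proof. by rewrite /lun /lunV eqhom_comp eqhom_id. Qed.
Lemma lunV_lun X : lunV X \o lun X = idm _.
Proof. by rewrite /lun /lunV eqhom_comp eqhom_id. Qed.

Lemma asc_nat X X' Y Y' Z Z' (f : Hom X X') (g : Hom Y Y') (h : Hom Z Z') :
  asc X' Y' Z' \o ((f ⊗₁ g) ⊗₁ h) = (f ⊗₁ (g ⊗₁ h)) \o asc X Y Z.
Proof. exact: tensmA. Qed.

Lemma ascV_nat X X' Y Y' Z Z' (f : Hom X X') (g : Hom Y Y') (h : Hom Z Z') :
  ascV X' Y' Z' \o (f ⊗₁ (g ⊗₁ h)) = ((f ⊗₁ g) ⊗₁ h) \o ascV X Y Z.
Proof.
rewrite -[LHS]compm1 -(asc_ascV X Y Z) !compA; congr (_ \o _).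
by rewrite -compA -asc_nat compA ascV_asc comp1m.
Qed.

Lemma run_nat X X' (f : Hom X X') : run X' \o (f ⊗₁ idm one) = f \o run X.
Proof. exact: tensm1r. Qed.
Lemma lun_nat X X' (f : Hom X X') : lun X' \o (idm one ⊗₁ f) = f \o lun X.
Proof. exact: tensm1l. Qed.
Lemma runV_nat X X' (f : Hom X X') : runV X' \o f = (f ⊗₁ idm one) \o runV X.
Proof.
by rewrite -[f in LHS]compm1 -(run_runV X) !compA -(compA (runV X')) -run_nat
  !compA runV_run comp1m.
Qed.
Lemma lunV_nat X X' (f : Hom X X') : lunV X' \o f = (idm one ⊗₁ f) \o lunV X.
Proof.
by rewrite -[f in LHS]compm1 -(lun_lunV X) !compA -(compA (lunV X')) -lun_nat
  !compA lunV_lun comp1m.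
Qed.

Variable D : rigid C.

(* - ⊗ X is left adjoint to - ⊗ X^*, and X ⊗ - to *X ⊗ -. *)
Definition curr X M N (f : Hom (M ⊗ X) N) : Hom M (N ⊗ ld D X) :=
  (f ⊗₁ idm _) \o ascV M X (ld D X) \o (idm M ⊗₁ coev D X) \o runV M.
Definition uncurr X M N (g : Hom M (N ⊗ ld D X)) : Hom (M ⊗ X) N :=
  run N \o (idm N ⊗₁ ev D X) \o asc N (ld D X) X \o (g ⊗₁ idm X).
Definition curl X M N (f : Hom (X ⊗ M) N) : Hom M (rd D X ⊗ N) :=
  (idm _ ⊗₁ f) \o asc (rd D X) X M \o (coev' D X ⊗₁ idm M) \o lunV M.
Definition uncurl X M N (g : Hom M (rd D X ⊗ N)) : Hom (X ⊗ M) N :=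
  lun N \o (ev' D X ⊗₁ idm N) \o ascV X (rd D X) N \o (idm X ⊗₁ g).

Lemma curr_natl X M M' N (f : Hom (M ⊗ X) N) (h : Hom M' M) :
  curr (f \o (h ⊗₁ idm X)) = curr f \o h.
Proof.
rewrite /curr -[RHS]compA runV_nat compl_tensm -!compA; congr (_ \o _).
rewrite (compA _ (ascV _ _ _)) -ascV_nat -!compA; congr (_ \o _).
rewrite !compA; congr (_ \o _).
by rewrite tensm_id tensm_split tensm_split'.
Qed.

Lemma uncurr_natr X M N N' (g : Hom M (N ⊗ ld D X)) (e : Hom N N') :
  uncurr ((e ⊗₁ idm _) \o g) = e \o uncurr g.
Proof.
rewrite /uncurr compl_tensm !compA; congr (_ \o _).
rewrite -(compA _ (asc _ _ _)) asc_nat !compA; congr (_ \o _).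
rewrite -run_nat -!compA; congr (_ \o _).
by rewrite tensm_id tensm_split tensm_split'.
Qed.

Lemma curl_natl X M M' N (f : Hom (X ⊗ M) N) (h : Hom M' M) :
  curl (f \o (idm X ⊗₁ h)) = curl f \o h.
Proof.
rewrite /curl -[RHS]compA lunV_nat compr_tensm -!compA; congr (_ \o _).
rewrite (compA _ (asc _ _ _)) -asc_nat -!compA; congr (_ \o _).
rewrite !compA; congr (_ \o _).
by rewrite tensm_id tensm_split tensm_split'.
Qed.

Lemma uncurl_natr X M N N' (g : Hom M (rd D X ⊗ N)) (e : Hom N N') :
  uncurl ((idm _ ⊗₁ e) \o g) = e \o uncurl g.
Proof.
rewrite /uncurl compr_tensm !compA; congr (_ \o _).
rewrite -(compA _ (ascV _ _ _)) ascV_nat !compA; congr (_ \o _).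
rewrite -lun_nat -!compA; congr (_ \o _).
by rewrite tensm_id tensm_split tensm_split'.
Qed.

Lemma currK X M N (f : Hom (M ⊗ X) N) : uncurr (curr f) = f.
Proof.
have cur1 : uncurr (curr (idm (M ⊗ X))) = idm (M ⊗ X).
  rewrite /uncurr /curr tensm_id comp1m !compl_tensm !compA.
  have -> : idm (M ⊗ X) ⊗₁ ev D X =
      ascV M X one \o (idm M ⊗₁ (idm X ⊗₁ ev D X)) \o asc M X (ld D X ⊗ X).
    by rewrite ascV_nat -compA ascV_asc compm1 tensm_id.
  have -> : (idm M ⊗₁ coev D X) ⊗₁ idm X =
      ascV M (X ⊗ ld D X) X \o (idm M ⊗₁ (coev D X ⊗₁ idm X)) \o asc M one X.
    by rewrite ascV_nat -compA ascV_asc compm1.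
  rewrite -[RHS]tensm_id -[W in _ = _ ⊗₁ W](ev_coev D X) !compr_tensm.
  have -> : idm M ⊗₁ asc X (ld D X) X =
      asc M X (ld D X ⊗ X) \o asc (M ⊗ X) (ld D X) X
        \o (ascV M X (ld D X) ⊗₁ idm X) \o ascV M (X ⊗ ld D X) X.
    rewrite -[idm M]/(eqhom erefl) -[idm X]/(eqhom erefl) /asc /ascV.
    by rewrite !eqhom_tens !eqhom_comp; apply: eqhom_irr.
  have -> : idm M ⊗₁ run X = run (M ⊗ X) \o ascV M X one.
    rewrite -[idm M]/(eqhom erefl) /run /ascV eqhom_tens eqhom_comp.
    exact: eqhom_irr.
  have -> : idm M ⊗₁ lunV X = asc M one X \o (runV M ⊗₁ idm X).
    rewrite -[idm M]/(eqhom erefl) -[idm X]/(eqhom erefl) /lunV /asc /runV.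
    by rewrite !eqhom_tens eqhom_comp; apply: eqhom_irr.
  by rewrite !compA.
rewrite -[f in LHS]compm1.
have -> : curr (f \o idm (M ⊗ X)) = (f ⊗₁ idm _) \o curr (idm (M ⊗ X)).
  by rewrite /curr compm1 tensm_id comp1m !compA.
by rewrite uncurr_natr cur1 compm1.
Qed.

Lemma curlK X M N (f : Hom (X ⊗ M) N) : uncurl (curl f) = f.
Proof.
have cur1 : uncurl (curl (idm (X ⊗ M))) = idm (X ⊗ M).
  rewrite /uncurl /curl tensm_id comp1m !compr_tensm !compA.
  have -> : ev' D X ⊗₁ idm (X ⊗ M) =
      asc one X M \o ((ev' D X ⊗₁ idm X) ⊗₁ idm M) \o ascV (X ⊗ rd D X) X M.
    by rewrite asc_nat -compA asc_ascV compm1 tensm_id.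
  have -> : idm X ⊗₁ (coev' D X ⊗₁ idm M) =
      asc X (rd D X ⊗ X) M \o ((idm X ⊗₁ coev' D X) ⊗₁ idm M) \o ascV X one M.
    by rewrite asc_nat -compA asc_ascV compm1.
  rewrite -[RHS]tensm_id -[W in _ = W ⊗₁ _](ev_coev' D X) !compl_tensm.
  have -> : ascV X (rd D X) X ⊗₁ idm M =
      ascV (X ⊗ rd D X) X M \o ascV X (rd D X) (X ⊗ M)
        \o (idm X ⊗₁ asc (rd D X) X M) \o asc X (rd D X ⊗ X) M.
    rewrite -[idm M]/(eqhom erefl) -[idm X]/(eqhom erefl) /asc /ascV.
    by rewrite !eqhom_tens !eqhom_comp; apply: eqhom_irr.
  have -> : lun X ⊗₁ idm M = lun (X ⊗ M) \o asc one X M.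
    rewrite -[idm M]/(eqhom erefl) /lun /asc eqhom_tens eqhom_comp.
    exact: eqhom_irr.
  have -> : runV X ⊗₁ idm M = ascV X one M \o (idm X ⊗₁ lunV M).
    rewrite -[idm M]/(eqhom erefl) -[idm X]/(eqhom erefl) /lunV /ascV /runV.
    by rewrite !eqhom_tens eqhom_comp; apply: eqhom_irr.
  by rewrite !compA.
rewrite -[f in LHS]compm1.
have -> : curl (f \o idm (X ⊗ M)) = (idm _ ⊗₁ f) \o curl (idm (X ⊗ M)).
  by rewrite /curl compm1 tensm_id comp1m !compA.
by rewrite uncurl_natr cur1 compm1.
Qed.

Lemma epi_tensr X M N (e : Hom M N) : is_epi e -> is_epi (e ⊗₁ idm X).
Proof.
move=> epi_e Z g h eq_gh; rewrite -[g]currK -[h]currK; congr uncurr.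
by apply: epi_e; rewrite -!curr_natl eq_gh.
Qed.

Lemma epi_tensl X M N (e : Hom M N) : is_epi e -> is_epi (idm X ⊗₁ e).
Proof.
move=> epi_e Z g h eq_gh; rewrite -[g]curlK -[h]curlK; congr uncurl.
by apply: epi_e; rewrite -!curl_natl eq_gh.
Qed.

Lemma projective_tensr P X : projective P -> projective (P ⊗ X).
Proof.
move=> projP Y Z e f epi_e.
have [g eg] := projP _ _ _ (curr f) (epi_tensr (X := ld D X) epi_e).
by exists (uncurr g); rewrite -uncurr_natr eg currK.
Qed.

Lemma projective_tensl P X : projective P -> projective (X ⊗ P).
Proof.
move=> projP Y Z e f epi_e.
have [g eg] := projP _ _ _ (curl f) (epi_tensl (X := rd D X) epi_e).
by exists (uncurl g); rewrite -uncurl_natr eg curlK.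
Qed.

End ProjectiveTensor.

Section Copowers.
Variables (k : fieldType) (C : lincat k).

(* The objects V · M, via Hom(V · M, N) ≅ Hom_k(V, Hom(M, N)) natural in N. *)
Record copowers := Copowers {
  cpw : vectType k -> C -> C;
  cpw_hom : forall (V : vectType k) (M N : C),
    Hom (cpw V M) N -> 'Hom(V, Hom M N);
  cpw_inv : forall (V : vectType k) (M N : C),
    'Hom(V, Hom M N) -> Hom (cpw V M) N;
  cpw_lin : forall V M N, linear (@cpw_hom V M N);
  cpw_homK : forall V M N, cancel (@cpw_hom V M N) (@cpw_inv V M N);
  cpw_invK : forall V M N, cancel (@cpw_inv V M N) (@cpw_hom V M N);
  cpw_nat : forall (V : vectType k) (M N N' : C)
    (g : Hom N N') (h : Hom (cpw V M) N),
    cpw_hom (g \o h) = (postcomp M g \o cpw_hom h)%VF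
}.

Variable P : copowers.

(* a · f : V · M -> W · N *)
Definition cpwm (V W : vectType k) (M N : C) (a : 'Hom(V, W)) (f : Hom M N) :
  Hom (cpw P V M) (cpw P W N) :=
  cpw_inv P (precomp (cpw P W N) f \o cpw_hom (idm (cpw P W N)) \o a)%VF.

Definition dualv (V : vectType k) : vectType k := 'Hom(V, k^o).
Definition transp (V W : vectType k) (a : 'Hom(V, W)) :
  'Hom(dualv W, dualv V) := linfun (fun phi : dualv W => (phi \o a)%VF).

Definition dinatural (M W : C)
    (j : forall Z : C, Hom (cpw P (dualv (Hom M Z)) Z) W) : Prop :=
  forall (Z Z' : C) (h : Hom Z Z'),
    j Z' \o cpwm \1%VF h = j Z \o cpwm (transp (postcomp M h)) (idm Z).

End Copowers.
Arguments cpwm {k C} P {V W M N}.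

(* N(M) is the coend of (Z', Z) |-> Hom(M, Z')^* · Z.  The action of N on
   morphisms is determined by the universal property and is not needed here. *)
Record nakayama (k : fieldType) (C : lincat k) := Nakayama {
  nk_cpw : copowers C;
  nk :> C -> C;
  nk_i : forall Z M : C, Hom (cpw nk_cpw (dualv (Hom M Z)) Z) (nk M);
  nk_dinat : forall M : C, dinatural (fun Z => nk_i Z M);
  nk_univ : forall (M W : C)
    (j : forall Z : C, Hom (cpw nk_cpw (dualv (Hom M Z)) Z) W),
    dinatural j ->
    exists! u : Hom (nk M) W, forall Z, u \o nk_i Z M = j Z
}.

Section NakayamaTensor.
Variables (k : fieldType) (C : ftcat k) (N : nakayama C).
Local Notation P := (nk_cpw N).

(* The canonical isomorphisms V · (Z ⊗ Y) -> (V · Z) ⊗ Y and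
   V · (Y ⊗ Z) -> Y ⊗ (V · Z). *)
Definition cpw_tensr (V : vectType k) (Z Y : C) :
  Hom (cpw P V (Z ⊗ Y)) (cpw P V Z ⊗ Y) :=
  cpw_inv P (linfun (fun f : Hom Z (cpw P V Z) => f ⊗₁ idm Y)
               \o cpw_hom (idm (cpw P V Z)))%VF.
Definition cpw_tensl (V : vectType k) (Y Z : C) :
  Hom (cpw P V (Y ⊗ Z)) (Y ⊗ cpw P V Z) :=
  cpw_inv P (linfun (fun f : Hom Z (cpw P V Z) => idm Y ⊗₁ f)
               \o cpw_hom (idm (cpw P V Z)))%VF.

Record nakayama_tensor := NakayamaTensor {
  nkPsi : forall M X : C, Hom (N M ⊗ X^LL) (N (M ⊗ X));
  nkPsiV : forall M X : C, Hom (N (M ⊗ X)) (N M ⊗ X^LL);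
  nkPsiK : forall M X, nkPsiV M X \o nkPsi M X = idm _;
  nkPsiVK : forall M X, nkPsi M X \o nkPsiV M X = idm _;
  nkPsiE : forall M X Z : C,
    nkPsi M X \o (nk_i N Z M ⊗₁ idm X^LL) \o cpw_tensr _ Z X^LL =
    nk_i N (Z ⊗ X^LL) (M ⊗ X)
      \o cpwm P (transp (linfun (@clr k C M Z X))) (idm (Z ⊗ X^LL));
  nkPhi : forall X M : C, Hom (X^RR ⊗ N M) (N (X ⊗ M));
  nkPhiV : forall X M : C, Hom (N (X ⊗ M)) (X^RR ⊗ N M);
  nkPhiK : forall X M, nkPhiV X M \o nkPhi X M = idm _;
  nkPhiVK : forall X M, nkPhi X M \o nkPhiV X M = idm _;
  nkPhiE : forall X M Z : C,
    nkPhi X M \o (idm X^RR ⊗₁ nk_i N Z M) \o cpw_tensl _ X^RR Z =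
    nk_i N (X^RR ⊗ Z) (X ⊗ M)
      \o cpwm P (transp (linfun (@cll k C X M Z))) (idm (X^RR ⊗ Z))
}.

Lemma tens_one_comm (X : C) : X ⊗ one = one ⊗ X.
Proof. by rewrite tenso1 tens1o. Qed.

Definition radford (S : nakayama_tensor) (X : C) :
  Hom (X^RR ⊗ N one) (N one ⊗ X^LL) :=
  nkPsiV S one X \o eqhom (f_equal N (tens_one_comm X)) \o nkPhi S X one.

End NakayamaTensor.

Definition unimodular (k : fieldType) (C : ftcat k) (N : nakayama C) : Prop :=
  isomorphic (N one) one.

(* The coend, and with it Psi and Phi, is unique up to unique isomorphism, so
   the choice of the data N and S is immaterial. *)
Definition spherical (k : fieldType) (C : ftcat k) (p : pivotal C) : Prop :=
  exists (N : nakayama C) (S : nakayama_tensor N),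
    unimodular N /\
    exists f : Hom one (N one), is_iso f /\
      forall X : C,
        radford S X \o (idm X^RR ⊗₁ f) =
        (f ⊗₁ idm X^LL) \o lunV X^LL \o piv p X \o pivrr p X \o run X^RR.

Section Traces.
Variables (k : fieldType) (C : ftcat k) (p : pivotal C).

Record projobj := ProjObj { pobj :> C; pobj_proj : projective pobj }.
Arguments pobj_proj : clear implicits.

Definition ptensr (P : projobj) (X : C) : projobj :=
  ProjObj (projective_tensr (X := X) (ft_rigid C) (pobj_proj P)).
Definition ptensl (X : C) (P : projobj) : projobj :=
  ProjObj (projective_tensl (X := X) (ft_rigid C) (pobj_proj P)).

Definition trfam := forall P : projobj, 'Hom(Hom P P, k^o).

Record modified_trace (t : trfam) : Prop := ModifiedTrace {
  mt_cyclic : forall (P Q : projobj) (f : Hom P Q) (g : Hom Q P),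
    t P (g \o f) = t Q (f \o g);
  mt_right : forall (P : projobj) (X : C) (f : Hom (P ⊗ X) (P ⊗ X^LL)),
    t P (clr f) = t (ptensr P X) ((idm P ⊗₁ pivV p X) \o f);
  mt_left : forall (P : projobj) (X : C) (f : Hom (X ⊗ P) (X^RR ⊗ P)),
    t P (cll f) = t (ptensl X P) ((pivrr p X ⊗₁ idm P) \o f)
}.

Definition tr_nonzero (t : trfam) : Prop := exists P, t P <> 0.

Definition tr_nondegenerate (t : trfam) : Prop :=
  forall (M : C) (P : projobj),
    (forall f : Hom M P, (forall g : Hom P M, t P (f \o g) = 0) -> f = 0) /\
    (forall g : Hom P M, (forall f : Hom M P, t P (f \o g) = 0) -> g = 0).

End Traces.

(* Main.v *)
Require Import Defs.
From mathcomp Require Import all_boot all_algebra falgebra.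
From mathcomp Require Import boolp.
From HB Require Import structures.
Import Defs.

Set Implicit Arguments.
Unset Strict Implicit.
Unset Printing Implicit Defensive.

Import GRing.Theory.
Local Open Scope ring_scope.
Local Open Scope cat_scope.

(** Cyclic families t on Proj(C) correspond to natural transformations
    eta : id -> N, where eta_P is the value at t_P of the universal dinatural
    map Hom(P, P)^* -> Hom(P, N(P)), which is bijective for projective P.  The
    two partial trace conditions say that eta is compatible with Psi and Phi,
    up to the pivotal structure; thus eta is determined by a = eta_1 : 1 -> N(1)
    through Psi as well as through Phi, and the two resulting extensions of a
    agree exactly when a satisfies the spherical identity.  To get a from t, one
    factors N(e) eta_P through an epimorphism e : P -> 1 from a projective P.

    If t <> 0, then a <> 0 is mono since 1 is simple, so eta_G is mono for a
    progenerator G; as Hom(G, N(G)) and Hom(G, G)^* have the same dimension,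
    eta_G is invertible, and hence so is a.  Invertibility of eta gives
    non-degeneracy, and End(1) = k gives uniqueness up to a scalar.

    The coend N(M) is the object for which Hom(G, N(M)) is the End(G)-module
    Hom(M, G)^*; Psi and Phi come from the chains of adjunctions
    - ⊗ X -| - ⊗ X^* -| - ⊗ X^** and X ⊗ - -| *X ⊗ - -| **X ⊗ -. *)

(** * Preliminaries from linear algebra *)

Lemma is_linear_sum (k : fieldType) (U V : vectType k) (f : U -> V) I
    (r : seq I) (F : I -> U) :
  linear f -> f (\sum_(i <- r) F i) = \sum_(i <- r) f (F i).
Proof.
move=> L; pose LM := GRing.isLinear.Build _ _ _ _ _ L.
pose F0 : {linear U -> V} := HB.pack f LM.
exact: (linear_sum F0).
Qed.

(** The quotient by [I] is realized on a complement of [I]: [s] is the projection along [I] and [r]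
    the inclusion of the complement. *)
Lemma lfun_coker (k : fieldType) (W : vectType k) (I : {vspace W}) :
  exists (V : vectType k) (s : 'Hom(W, V)) (r : 'Hom(V, W)),
    (forall v, s (r v) = v) /\ (forall w, (s w == 0) = (w \in I)).
Proof.
pose V : vectType k := subvs_of (I^C)%VS.
have cC : ((I^C)%VS :&: I = 0)%VS by rewrite capvC capv_compl.
exists V, (linfun (vsproj (I^C)%VS) \o daddv_pi (I^C) I)%VF, (linfun vsval).
split=> [v | w].
  by rewrite comp_lfunE !lfunE /= daddv_pi_id ?subvsP ?vsvalK.
rewrite comp_lfunE lfunE /=.
have wE : daddv_pi (I^C) I w + daddv_pi I (I^C) w = w.
  by apply: daddv_pi_add; rewrite // addvC addv_complf memvf.
apply/eqP/idP => [w0 | wI].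
  rewrite -wE -(vsprojK (memv_pi (I^C) I w)) w0 linear0 add0r.
  exact: memv_pi.
(* This component is [w] minus its component in [I], so for [w] in [I] it lies in both [I] and its
   complement. *)
suff -> : daddv_pi (I^C) I w = 0 by rewrite linear0.
apply/eqP; rewrite -memv0 -cC memv_cap memv_pi /=.
by rewrite -(addrK (daddv_pi I (I^C) w) (daddv_pi _ _ _)) wE memvB ?memv_pi.
Qed.

(** * Progenerators *)

Section LinCat.
Variables (k : fieldType) (C : lincat k).
Implicit Types X Y Z W : C.

Lemma postcompE X Y Z (g : Hom Y Z) (f : Hom X Y) : postcomp X g f = g \o f.
Proof. by rewrite /postcomp linfun_linE //; apply: comp_linr. Qed.

Lemma precompE X Y Z (f : Hom X Y) (g : Hom Y Z) : precomp Z f g = g \o f.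
Proof. by rewrite /precomp linfun_linE //; apply: comp_linl. Qed.

Lemma compm0 X Y Z (g : Hom Y Z) : g \o (0 : Hom X Y) = 0.
Proof. by rewrite -postcompE linear0. Qed.
Lemma comp0m X Y Z (f : Hom X Y) : (0 : Hom Y Z) \o f = 0.
Proof. by rewrite -precompE linear0. Qed.
Lemma compBm X Y Z (f : Hom X Y) (g h : Hom Y Z) :
  (g - h) \o f = (g \o f) - (h \o f).
Proof. by rewrite -!precompE linearB. Qed.
Lemma compmB X Y Z (f g : Hom X Y) (h : Hom Y Z) :
  h \o (f - g) = (h \o f) - (h \o g).
Proof. by rewrite -!postcompE linearB. Qed.
Lemma compZm X Y Z c (f : Hom X Y) (g : Hom Y Z) :
  (c *: g) \o f = c *: (g \o f).
Proof. by rewrite -!precompE linearZ. Qed.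
Lemma compmZ X Y Z c (f : Hom X Y) (g : Hom Y Z) :
  g \o (c *: f) = c *: (g \o f).
Proof. by rewrite -!postcompE linearZ. Qed.
Lemma compm_sum X Y Z I (r : seq I) (F : I -> Hom X Y) (g : Hom Y Z) :
  g \o (\sum_(i <- r) F i) = \sum_(i <- r) (g \o F i).
Proof. by apply: is_linear_sum; apply: comp_linr. Qed.
Lemma comp_summ X Y Z I (r : seq I) (F : I -> Hom Y Z) (f : Hom X Y) :
  (\sum_(i <- r) F i) \o f = \sum_(i <- r) (F i \o f).
Proof. exact: is_linear_sum (comp_linl f). Qed.

Lemma is_iso_comp X Y Z (g : Hom Y Z) (f : Hom X Y) :
  is_iso g -> is_iso f -> is_iso (g \o f).
Proof.
move=> [g' [g'g gg']] [f' [f'f ff']]; exists (f' \o g'); split.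
  by rewrite compA -(compA f') g'g compm1.
by rewrite compA -(compA g) ff' compm1.
Qed.

Lemma eqhom_iso X Y (e : X = Y) : is_iso (eqhom e).
Proof. by exists (eqhom (esym e)); rewrite !eqhom_comp !eqhom_id. Qed.

(* The image of the regular module: Hom(G, -) identifies C with the category of
   finite-dimensional right End(G)-modules. *)
Record is_progen (G : C) : Prop := IsProgen {
  pg_faith : forall X Y (h h' : Hom X Y),
    (forall x : Hom G X, h \o x = h' \o x) -> h = h';
  pg_full : forall X Y (T : Hom G X -> Hom G Y), linear T ->
    (forall (x : Hom G X) (e : Hom G G), T (x \o e) = T x \o e) ->
    exists h : Hom X Y, forall x, T x = h \o x;
  pg_ess : forall (V : vectType k) (act : Hom G G -> V -> V),
    (forall e, linear (act e)) -> (forall v, linear (act^~ v)) ->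
    (forall v, act (idm G) v = v) ->
    (forall e e' v, act (e \o e') v = act e' (act e v)) ->
    exists (X : C) (T : 'Hom(Hom G X, V)), bijective T /\
      forall (x : Hom G X) (e : Hom G G), T (x \o e) = act e (T x)
}.

End LinCat.

(** * The regular module is a progenerator *)

Section Modcat.
Variables (k : fieldType) (A : falgType k).

Lemma amullE (a x : A) : linfun (@amull k A) a x = a * x.
Proof. by rewrite lfunE /= lfunE. Qed.

Lemma regmod_act1 : linfun (@amull k A) 1 = \1%VF.
Proof. by apply/lfunP => x; rewrite amullE id_lfunE mul1r. Qed.

Lemma regmod_actM (a b : A) :
  linfun (@amull k A) (a * b) =
  (linfun (@amull k A) a \o linfun (@amull k A) b)%VF.
Proof. by apply/lfunP => x; rewrite comp_lfunE !amullE mulrA. Qed.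

Definition regmod : fdmod A := FdMod regmod_act1 regmod_actM.

Lemma regmod_act (a : A) (x : regmod) : mact regmod a x = (a * x : A).
Proof. exact: amullE. Qed.

(** The inverse of evaluation at 1, giving the bijection between Hom(A, V) and V. For V = A these
    are the right multiplications. *)
Definition rmul (V : fdmod A) (v : V) : @Hom k (modcat A) regmod V :=
  vsproj (mhom regmod V) (linfun (fun a : A => mact V a v) : 'Hom(regmod, V)).

Lemma rmulE (V : fdmod A) (v : V) (a : A) : vsval (rmul v) a = mact V a v.
Proof.
have L : linear (fun a : A => mact V a v).
  by move=> c x y; rewrite linearP /= add_lfunE scale_lfunE.
rewrite vsprojK ?(linfun_linE L) //.
apply/mhomP => b w; rewrite regmod_act !(linfun_linE L).
by rewrite mactM comp_lfunE.
Qed.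

Lemma rmul_val (V : fdmod A) (f : @Hom k (modcat A) regmod V) :
  rmul (vsval f (1 : A)) = f.
Proof.
apply: val_inj; apply/lfunP => a.
rewrite -[LHS]/(vsval (rmul _) a) -[RHS]/(vsval f a) rmulE.
by rewrite -(mhomP _ (subvsP f)) regmod_act mulr1.
Qed.

Lemma modcat_valP (U V : fdmod A) c (f g : @Hom k (modcat A) U V) u :
  vsval (c *: f + g) u = c *: vsval f u + vsval g u.
Proof.
by rewrite -scale_lfunE -add_lfunE.
Qed.

Lemma rmul_lin (V : fdmod A) : linear (@rmul V).
Proof.
move=> c x y; apply: val_inj; apply/lfunP => a.
rewrite -[LHS]/(vsval (rmul _) a) rmulE.
by rewrite -[RHS]/(vsval (c *: rmul x + rmul y) a) modcat_valP !rmulE linearP.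
Qed.

Lemma modcat_compE (U V W : fdmod A) (g : @Hom k (modcat A) V W)
    (f : @Hom k (modcat A) U V) u :
  vsval (g \o f : subvs_of (mhom U W)) u = vsval g (vsval f u).
Proof. by rewrite [X in fun_of_lfun X]mhom_compE comp_lfunE. Qed.

Lemma modcat_idE (V : fdmod A) (v : V) :
  vsval (idm (V : modcat A) : subvs_of (mhom V V)) v = v.
Proof. by rewrite [vsval _]mhom_idE id_lfunE. Qed.

Lemma modcat_hom_eq (U V : fdmod A) (f g : @Hom k (modcat A) U V) :
  (forall u, vsval f u = vsval g u) -> f = g.
Proof. by move=> fg; apply: val_inj; apply/lfunP. Qed.

(** Evaluation at 1 identifies Hom(A, V) with V, and precomposition with a right multiplication by a
    with the action of a. Composing right multiplications reverses products, so right End(A)-modules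
    are left A-modules. *)
Lemma modcat_progen : @is_progen k (modcat A) regmod.
Proof.
split.
- move=> X Y h h' hh'; apply: modcat_hom_eq => v.
  have := congr1 (fun f : @Hom k (modcat A) regmod Y => vsval f (1 : A))
    (hh' (rmul v)).
  by rewrite !modcat_compE rmulE mact1 id_lfunE.
- move=> X Y T Tlin TE.
  pose h0 (v : X) : Y := vsval (T (rmul v)) (1 : A).
  have h0L : linear h0.
    move=> c u v; rewrite /h0 rmul_lin Tlin.
    by rewrite modcat_valP.
  have hm : linfun h0 \in mhom X Y.
    apply/mhomP => a v; rewrite !(linfun_linE h0L) /h0.
    have -> : rmul (mact X a v) = rmul v \o (rmul (a : regmod)).
      apply: modcat_hom_eq => b; rewrite modcat_compE !rmulE.
      by rewrite -comp_lfunE -mactM regmod_act.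
    rewrite TE modcat_compE rmulE regmod_act mul1r.
    by rewrite -(mhomP _ (subvsP _)) regmod_act mulr1.
  exists (vsproj (mhom X Y) (linfun h0)) => x.
  rewrite -[LHS]rmul_val -[RHS]rmul_val modcat_compE vsprojK //.
  by rewrite (linfun_linE h0L) /h0 !rmul_val.
- move=> V act actl actr act1 actM.
  pose R (a : A) : 'Hom(V, V) := linfun (act (rmul (a : regmod))).
  have RE a v : R a v = act (rmul (a : regmod)) v.
    by rewrite (linfun_linE (actl _)).
  have RL : linear R.
    move=> c a b; apply/lfunP => v.
    by rewrite add_lfunE scale_lfunE !RE rmul_lin actr.
  have R1 : linfun R 1 = \1%VF.
    rewrite (linfun_linE RL); apply/lfunP => v; rewrite RE id_lfunE.
    rewrite -[RHS]act1; congr act; apply: modcat_hom_eq => b.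
    by rewrite rmulE regmod_act mulr1 modcat_idE.
  have RM (a b : A) : linfun R (a * b) = (linfun R a \o linfun R b)%VF.
    rewrite !(linfun_linE RL); apply/lfunP => v; rewrite comp_lfunE !RE -actM.
    congr act; apply: modcat_hom_eq => c.
    by rewrite modcat_compE !rmulE !regmod_act mulrA.
  pose X : fdmod A := @FdMod k A V (linfun R) R1 RM.
  pose T0 (f : @Hom k (modcat A) regmod X) : V := vsval f (1 : A).
  have TL : linear T0.
    by move=> c f g; rewrite /T0 modcat_valP.
  exists X, (linfun T0); split.
    exists (fun v : V => rmul (v : X)) => [f | v].
      by rewrite (linfun_linE TL) /T0 rmul_val.
    by rewrite (linfun_linE TL) /T0 rmulE mact1 id_lfunE.
  move=> x e; rewrite !(linfun_linE TL) /T0 modcat_compE.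
  set y : A := vsval e _; rewrite -[y]mulr1 -[y * 1]regmod_act.
  rewrite (mhomP _ (subvsP x)) /= (linfun_linE RL) RE.
  by rewrite rmul_val.
Qed.

End Modcat.

(** * Transfer of progenerators along equivalences *)

Section Equivalence.
Variable k : fieldType.

Lemma nat_iso_faithful (C D : lincat k) (F : linfunctor C D)
    (G : linfunctor D C) :
  nat_isomorphic (functor_comp G F) (functor_id C) ->
  forall X Y : C, injective (fmor F : Hom X Y -> _).
Proof.
move=> [a [aI aN]] X Y f g fg; have := aN _ _ f; have := aN _ _ g.
rewrite /= !comp_lfunE !id_lfunE fg => -> fga.
have [b [ba ab]] := aI X.
by rewrite -[f]compm1 -[g]compm1 -ab !compA -[f \o _]fga.
Qed.

(** The preimage of g is G(g) conjugated by the isomorphism from GF to the identity; it suffices to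
    compare after applying G, which is faithful. *)
Lemma nat_iso_full (C D : lincat k) (F : linfunctor C D) (G : linfunctor D C) :
  nat_isomorphic (functor_comp G F) (functor_id C) ->
  nat_isomorphic (functor_comp F G) (functor_id D) ->
  forall (X Y : C) (g : Hom (F X) (F Y)), exists f : Hom X Y, fmor F f = g.
Proof.
move=> [a [aI aN]] FG X Y g.
have [b [ba ab]] := aI X; have [b' [ba' ab']] := aI Y.
exists (a Y \o fmor G g \o b).
apply: (nat_iso_faithful FG).
have := aN _ _ (a Y \o fmor G g \o b); rewrite /= !comp_lfunE id_lfunE => E.
rewrite -[LHS]comp1m -ba' -[b' \o a Y \o _]compA [a Y \o _]E -!compA.
by rewrite ba compm1 compA ba' comp1m.
Qed.

(** The quasi-inverse [H] is fully faithful and each object of [C] is isomorphic to some [H X'], so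
    every clause for [H G] is carried back to [G] along such isomorphisms. *)
Lemma progen_transfer (C D : lincat k) (G : D) :
  equivalent C D -> is_progen G -> exists G' : C, is_progen G'.
Proof.
move=> [F [H [HF FH]]] PG; exists (H G).
have Hinj := nat_iso_faithful FH; have Hfull := nat_iso_full FH HF.
have ess (X : C) : exists (X' : D) (i : Hom (H X') X) (j : Hom X (H X')),
    j \o i = idm _ /\ i \o j = idm _.
  by case: HF => a [aI _]; have [j ?] := aI X; exists (F X), (a X), j.
have lift (X Y : D) : exists L : Hom (H X) (H Y) -> Hom X Y,
    forall f, fmor H (L f) = f.
  pose L f := projT1 (cid (Hfull X Y f)); exists L => f.
  exact: (projT2 (cid (Hfull X Y f))).
split.
- move=> X Y h h' hh'.
  have [X' [i [j [ji ij]]]] := ess X; have [Y' [i' [j' [ji' ij']]]] := ess Y.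
  suff E : j' \o h \o i = j' \o h' \o i.
    have : i' \o (j' \o h \o i) \o j = i' \o (j' \o h' \o i) \o j by rewrite E.
    by rewrite !compA ij' !comp1m -!compA ij !compm1.
  have [f fE] := Hfull _ _ (j' \o h \o i).
  have [f' fE'] := Hfull _ _ (j' \o h' \o i).
  rewrite -fE -fE'; congr (fmor H _); apply: (pg_faith PG) => x; apply: Hinj.
  by rewrite !fmor_comp fE fE' -!compA hh'.
- move=> X Y T TL TE.
  have [X' [i [j [ji ij]]]] := ess X; have [Y' [i' [j' [ji' ij']]]] := ess Y.
  have [L LE] := lift G Y'.
  pose T' (x : Hom G X') : Hom G Y' := L (j' \o T (i \o fmor H x)).
  have TL' : linear T'.
    move=> c x y; apply: Hinj; rewrite [RHS]linearP /= !LE linearP /=.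
    by rewrite comp_linr TL comp_linr.
  have [|h hE] := pg_full PG TL'.
    move=> x e; apply: Hinj.
    by rewrite fmor_comp !LE fmor_comp compA TE compA.
  exists (i' \o fmor H h \o j) => x.
  have [y yE] := Hfull _ _ (j \o x).
  rewrite -[T x]comp1m -ij' -!compA -yE -fmor_comp -hE LE yE.
  by rewrite (compA i) ij comp1m.
- move=> V act actl actr act1 actM.
  pose act' (e : Hom G G) := act (fmor H e).
  have [||||X [T [[T' TK TK'] TE]]] := pg_ess PG (act := act').
  + by move=> e; apply: actl.
  + by move=> v c x y; rewrite /act' linearP actr.
  + by move=> v; rewrite /act' fmor_id act1.
  + by move=> e e' v; rewrite /act' fmor_comp actM.
  have [L LE] := lift G X; have [LG LGE] := lift G G.
  have LL : linear (fun x => T (L x)).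
    move=> c x y; rewrite -linearP; congr (T _).
    by apply: Hinj; rewrite linearP /= !LE.
  exists (H X), (linfun (fun x => T (L x))); split.
    exists (fun v => fmor H (T' v)) => [x | v]; rewrite (linfun_linE LL).
      by rewrite TK LE.
    by rewrite -[RHS]TK'; congr (T _); apply: Hinj; rewrite LE.
  move=> x e; rewrite !(linfun_linE LL) -[e in RHS]LGE -[act _]/(act' _) -TE.
  by congr (T _); apply: Hinj; rewrite fmor_comp !LE LGE.
Qed.

Lemma finite_abelian_progen (C : lincat k) :
  finite_abelian C -> exists G : C, is_progen G.
Proof.
by move=> [A CA]; apply: progen_transfer CA _; apply: modcat_progen.
Qed.

End Equivalence.

(** * Kernels, images, biproducts and copowers from a progenerator *)

Section Progenerator.
Variables (k : fieldType) (C : lincat k) (G : C) (PG : is_progen G).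
Implicit Types X Y Z W U : C.

Lemma pg_eq0 X : (forall x : Hom G X, x = 0) -> is_zero_obj X.
Proof. by move=> X0; apply: (pg_faith PG) => x; rewrite (X0 x) !compm0. Qed.

Lemma pg_surj_epi X Y (e : Hom X Y) :
  (forall y : Hom G Y, exists x, e \o x = y) -> is_epi e.
Proof.
move=> eS Z g h gh; apply: (pg_faith PG) => y.
by have [x <-] := eS y; rewrite !compA gh.
Qed.

Lemma pg_ker0_mono X Y (f : Hom X Y) :
  (forall x : Hom G X, f \o x = 0 -> x = 0) -> is_mono f.
Proof.
move=> f0 Z g h fgh; apply: (pg_faith PG) => z.
apply/eqP; rewrite -subr_eq0; apply/eqP; apply: f0.
by rewrite compmB !compA fgh subrr.
Qed.

Lemma mono_eq0 X Y Z (f : Hom X Y) (x : Hom Z X) :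
  is_mono f -> f \o x = 0 -> x = 0.
Proof. by move=> fM fx; apply: fM; rewrite fx compm0. Qed.

(** A stable subspace is a right End(G)-submodule, hence of the form Hom(G, U), and fullness lifts
    its inclusion to a morphism. *)
Lemma pg_sub X (I : {vspace Hom G X}) :
  (forall (x : Hom G X) (e : Hom G G), x \in I -> x \o e \in I) ->
  exists (U : C) (i : Hom U X), is_mono i /\
    forall x : Hom G X, x \in I <-> exists u : Hom G U, x = i \o u.
Proof.
move=> Ist; pose V : vectType k := subvs_of I.
pose act (e : Hom G G) (v : V) : V := vsproj I (vsval v \o e).
have actE e v : vsval (act e v) = vsval v \o e.
  by rewrite vsprojK // Ist ?subvsP.
have [||||U [T [[T' TK TK'] TE]]] := pg_ess PG (act := act).
- move=> e c u v; apply: val_inj; rewrite -![val _]/(vsval _) linearP /= !actE.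
  by rewrite linearP /= comp_linl.
- move=> v c e e'; apply: val_inj; rewrite -![val _]/(vsval _) linearP /= !actE.
  by rewrite comp_linr.
- by move=> v; apply: val_inj; rewrite -![val _]/(vsval _) actE compm1.
- move=> e e' v; apply: val_inj; rewrite -![val _]/(vsval _) !actE.
  by rewrite compA.
have [||i iE] := pg_full PG (T := fun x : Hom G U => vsval (T x)).
- by move=> c x y; rewrite !linearP.
- by move=> x e; rewrite TE actE.
exists U, i; split.
  apply: pg_ker0_mono => x; rewrite -iE => Tx.
  have {}Tx : T x = 0 by apply: val_inj; rewrite -![val _]/(vsval _) Tx linear0.
  by rewrite -[x]TK Tx -[RHS]TK linear0.
move=> x; split=> [xI | [u ->]]; last by rewrite -iE subvsP.
by exists (T' (vsproj I x)); rewrite -iE TK' vsprojK.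
Qed.

(** The object [Q] represents the quotient module of Hom(G, X) by [I]. *)
Lemma pg_quot X (I : {vspace Hom G X}) :
  (forall (x : Hom G X) (e : Hom G G), x \in I -> x \o e \in I) ->
  exists (Q : C) (q : Hom X Q), forall x : Hom G X, x \in I <-> q \o x = 0.
Proof.
move=> Ist; have [V [s [r [rK sE]]]] := lfun_coker I.
pose act (e : Hom G G) (v : V) : V := s (r v \o e).
have sact x e : s (x \o e) = act e (s x).
  apply/eqP; rewrite /act -subr_eq0 -linearB sE -compBm /=.
  by apply: Ist; rewrite -sE linearB /= rK subrr.
have [||||Q [T [[T' TK TK'] TE]]] := pg_ess PG (act := act).
- by move=> e c u v; rewrite /act linearP comp_linl linearP.
- by move=> v c e e'; rewrite /act comp_linr linearP.
- by move=> v; rewrite /act compm1 rK.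
- by move=> e e' v; rewrite -sact /act compA.
have T'L : linear T'.
  by move=> c x y; rewrite -[RHS]TK linearP /= !TK'.
have [||q qE] := pg_full PG (T := fun x : Hom G X => T' (s x)).
- by move=> c x y; rewrite linearP T'L.
- by move=> x e; rewrite -[RHS]TK TE TK' sact.
have T'0 : T' 0 = 0 by rewrite -[RHS]TK linear0.
exists Q, q => x; rewrite -qE -sE; split=> [/eqP-> // | /(congr1 T)].
by rewrite TK' linear0 => ->.
Qed.

(** The quotient of Y by the submodule of all composites with e kills e, so it is zero and the
    submodule is everything. *)
Lemma pg_epi_surj X Y (e : Hom X Y) :
  is_epi e -> forall y : Hom G Y, exists x, e \o x = y.
Proof.
move=> eE y; pose I := limg (postcomp G e).
have [|Q [q qE]] := @pg_quot Y I.
  move=> x f /memv_imgP[z _ ->]; rewrite postcompE -compA -postcompE.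
  by rewrite memv_img ?memvf.
have q0 : q = 0.
  apply: eE; rewrite comp0m; apply: (pg_faith PG) => x; rewrite comp0m -compA.
  by apply/qE; rewrite -postcompE memv_img ?memvf.
have /memv_imgP[x _ ->] : y \in I by apply/qE; rewrite q0 comp0m.
by exists x; rewrite postcompE.
Qed.

(** Such f is bijective on Hom(G, -); the inverse map is End(G)-linear and therefore comes from a
    morphism. *)
Lemma pg_bij_iso X Y (f : Hom X Y) : is_mono f -> is_epi f -> is_iso f.
Proof.
move=> fM fE; have fS := pg_epi_surj fE.
pose L (y : Hom G Y) := projT1 (cid (fS y)).
have LE y : f \o L y = y by apply: (projT2 (cid (fS y))).
have [||g gE] := pg_full PG (T := L).
- by move=> c x y; apply: fM; rewrite comp_linr !LE.
- by move=> x e; apply: fM; rewrite LE compA LE.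
have fg : f \o g = idm Y.
  by apply: (pg_faith PG) => y; rewrite -compA -gE LE comp1m.
by exists g; split=> //; apply: fM; rewrite compA fg comp1m compm1.
Qed.

(** Two preimages under e of one y differ by something killed by e, hence by f; so f applied to any
    choice of preimages is an End(G)-linear map, which lifts to a morphism. *)
Lemma pg_factor X Y W (e : Hom X Y) (f : Hom X W) : is_epi e ->
  (forall x : Hom G X, e \o x = 0 -> f \o x = 0) -> exists h, f = h \o e.
Proof.
move=> eE ef; have eS := pg_epi_surj eE.
pose L (y : Hom G Y) := projT1 (cid (eS y)).
have LE y : e \o L y = y by apply: (projT2 (cid (eS y))).
have fL (x x' : Hom G X) : e \o x = e \o x' -> f \o x = f \o x'.
  move=> xx'; apply/eqP; rewrite -subr_eq0 -compmB; apply/eqP; apply: ef.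
  by rewrite compmB xx' subrr.
have [||h hE] := pg_full PG (T := fun y => f \o L y).
- by move=> c x y; rewrite -comp_linr; apply: fL; rewrite comp_linr !LE.
- by move=> x g; rewrite -compA; apply: fL; rewrite compA !LE.
exists h; apply: (pg_faith PG) => x.
by rewrite -compA -hE; apply: fL; rewrite LE.
Qed.

(** The kernel of f is a subobject of X: it is zero, or all of X and then f = 0. *)
Lemma simple_mono X Y (f : Hom X Y) : simple_obj X -> f <> 0 -> is_mono f.
Proof.
move=> [X0 Xs] f0; pose I := lker (postcomp G f).
have IE x : (x \in I) = (f \o x == 0) by rewrite memv_ker postcompE.
have [|U [i [iM iE]]] := @pg_sub X I.
  by move=> x e; rewrite !IE compA => /eqP->; rewrite comp0m.
have [U0 | [j [_ ij]]] := Xs _ _ iM.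
  apply: pg_ker0_mono => x /eqP; rewrite -IE => /iE[u ->].
  by rewrite -[u]comp1m U0 comp0m compm0.
case: f0; apply: (pg_faith PG) => x; rewrite comp0m; apply/eqP; rewrite -IE.
by apply/iE; exists (j \o x); rewrite compA ij comp1m.
Qed.

(** The image of f is a subobject of Y: it is all of Y, or zero and then f = 0. *)
Lemma simple_epi X Y (f : Hom X Y) : simple_obj Y -> f <> 0 -> is_epi f.
Proof.
move=> [Y0 Ys] f0; pose I := limg (postcomp G f).
have [|U [i [iM iE]]] := @pg_sub Y I.
  move=> x e /memv_imgP[z _ ->]; rewrite postcompE -compA -postcompE.
  by rewrite memv_img ?memvf.
have [U0 | [j [_ ij]]] := Ys _ _ iM.
  case: f0; apply: (pg_faith PG) => x; rewrite comp0m.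
  have /iE[u ->] : f \o x \in I by rewrite -postcompE memv_img ?memvf.
  by rewrite -[u]comp1m U0 comp0m compm0.
apply: pg_surj_epi => y.
have /memv_imgP[x _ ->] : y \in I.
  by apply/iE; exists (j \o y); rewrite compA ij comp1m.
by exists x; rewrite postcompE.
Qed.

Lemma pg_projective : projective G.
Proof. by move=> Y Z e f /pg_epi_surj/(_ f)[g <-]; exists g. Qed.

Lemma pg_neq0 X : ~ is_zero_obj X -> idm G <> 0.
Proof.
by move=> X0 G0; apply/X0/pg_eq0 => x; rewrite -[x]compm1 G0 compm0.
Qed.

(** The object [S] represents the End(G)-module of n-tuples in Hom(G, X); coordinate maps and
    inclusions lift by fullness. *)
Lemma pg_biproduct n X : exists (S : C) (i : 'I_n -> Hom X S)
  (p : 'I_n -> Hom S X),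
  (forall a b, p a \o i b = if a == b then idm X else 0) /\
  \sum_a (i a \o p a) = idm S.
Proof.
pose V : vectType k := {ffun 'I_n -> Hom G X}.
pose act (e : Hom G G) (v : V) : V := [ffun a => v a \o e].
have [||||S [T [[T' TK TK'] TE]]] := pg_ess PG (act := act).
- move=> e c u v; apply/ffunP => a.
  by rewrite !ffunE comp_linl.
- by move=> v c e e'; apply/ffunP => a; rewrite !ffunE comp_linr.
- by move=> v; apply/ffunP => a; rewrite !ffunE compm1.
- by move=> e e' v; apply/ffunP => a; rewrite !ffunE compA.
have T'L : linear T'.
  by move=> c x y; rewrite -[RHS]TK linearP /= !TK'.
have pP a : exists p : Hom S X, forall s, (T s : V) a = p \o s.
  apply: (pg_full PG) => [c x y | x e]; first by rewrite linearP !ffunE.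
  by rewrite TE ffunE.
pose p a := projT1 (cid (pP a)).
have pE a s : (T s : V) a = p a \o s := projT2 (cid (pP a)) s.
pose J a (x : Hom G X) : V := [ffun b => if a == b then x else 0].
have iP a : exists i : Hom X S, forall x, T' (J a x) = i \o x.
  apply: (pg_full PG) => [c x y | x e].
    rewrite -T'L; congr T'; apply/ffunP => b; rewrite !ffunE.
    by case: eqP => // _; rewrite scaler0 addr0.
  rewrite -[RHS]TK TE TK'; congr T'; apply/ffunP => b; rewrite !ffunE.
  by case: eqP => // _; rewrite comp0m.
pose i a := projT1 (cid (iP a)).
have iE a x : T' (J a x) = i a \o x := projT2 (cid (iP a)) x.
exists S, i, p; split.
  move=> a b; apply: (pg_faith PG) => x.
  rewrite -compA -iE -pE TK' ffunE eq_sym.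
  by case: eqP => _; rewrite ?comp1m ?comp0m.
apply: (pg_faith PG) => s; rewrite comp_summ comp1m -[RHS]TK -[LHS]TK.
congr T'; rewrite linear_sum; apply/ffunP => b; rewrite sum_ffunE.
rewrite (bigD1 b) //= big1 ?addr0 => [|a ab].
  by rewrite -compA -iE TK' ffunE eqxx pE.
by rewrite -compA -iE TK' ffunE (negbTE ab).
Qed.

(** A dual basis: a basis of Hom(G, X) assembles into an epimorphism from a power of G onto X, which
    splits because X is projective. *)
Lemma pg_proj_decomp X : projective X ->
  exists n (z : 'I_n -> Hom G X) (m : 'I_n -> Hom X G),
    \sum_a (z a \o m a) = idm X.
Proof.
move=> XP; pose B := vbasis (fullv : {vspace Hom G X}).
pose n := \dim (fullv : {vspace Hom G X}).
have [S [i [p [pi ip]]]] := pg_biproduct n G.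
pose e : Hom S X := \sum_(a < n) (B`_a \o p a).
have eE : is_epi e.
  apply: pg_surj_epi => x.
  exists (\sum_a coord B a x *: i a).
  rewrite compm_sum [RHS](coord_vbasis (memvf x)); apply: eq_bigr => a _.
  rewrite compmZ comp_summ (bigD1 a) //= big1 => [|b ba].
    by rewrite -compA pi eqxx compm1 addr0.
  by rewrite -compA pi (negbTE ba) compm0.
have [s es] := XP _ _ e (idm X) eE.
exists n, (fun a : 'I_n => B`_a), (fun a => p a \o s); rewrite -es comp_summ.
by apply: eq_bigr => a _; rewrite compA.
Qed.

(** V · M is the sum of dim V copies of M, and the adjunction is written in coordinates with respect
    to a fixed basis of V. *)
Lemma pg_copowers : exists P : copowers C, True.
Proof.
pose n (V : vectType k) := \dim (fullv : {vspace V}).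
pose B (V : vectType k) := vbasis (fullv : {vspace V}).
pose dat (V : vectType k) M := cid (pg_biproduct (n V) M).
pose S V M := projT1 (dat V M).
pose dati V M := cid (projT2 (dat V M)).
pose i V M := projT1 (dati V M).
pose datp V M := cid (projT2 (dati V M)).
pose p V M := projT1 (datp V M).
have [pi ip] :
    (forall V M a b, p V M a \o i V M b = if a == b then idm M else 0)
    /\ (forall V M, \sum_a (i V M a \o p V M a) = idm (S V M)).
  by split=> V M; have [] := projT2 (datp V M).
have h0L V M N (h : Hom (S V M) N) :
    linear (fun v : V => \sum_a coord (B V) a v *: (h \o i V M a)).
  move=> c u v; rewrite scaler_sumr -big_split; apply: eq_bigr => a _.
  by rewrite linearP scalerDl scalerA.
pose hm (V : vectType k) (M N : C) (h : Hom (S V M) N) : 'Hom(V, Hom M N) :=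
  linfun (fun v : V => \sum_a coord (B V) a v *: (h \o i V M a)).
have hmE V M N (h : Hom (S V M) N) v :
  hm V M N h v = \sum_a coord (B V) a v *: (h \o i V M a).
  by rewrite (linfun_linE (h0L _ _ _ _)).
pose inv (V : vectType k) (M N : C) (al : 'Hom(V, Hom M N)) : Hom (S V M) N :=
  \sum_(a < n V) (al (B V)`_a \o p V M a).
have Bfree (V : vectType k) : free (B V) by apply/basis_free/vbasisP.
suff [cl cK cK' cN] : [/\ forall (V : vectType k) (M N : C), linear (hm V M N),
    forall (V : vectType k) (M N : C), cancel (hm V M N) (inv V M N),
    forall (V : vectType k) (M N : C), cancel (inv V M N) (hm V M N) &
    forall (V : vectType k) (M N N' : C) (g : Hom N N') (h : Hom (S V M) N),
      hm V M N' (g \o h) = (postcomp M g \o hm V M N h)%VF].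
  by exists (Copowers cl cK cK' cN).
split=> [V M N c f g | V M N h | V M N al | V M N N' g h].
- apply/lfunP => v; rewrite add_lfunE scale_lfunE !hmE scaler_sumr -big_split.
  apply: eq_bigr => a _ /=; rewrite comp_linl scalerDr !scalerA.
  by rewrite [c * _]mulrC.
- rewrite /inv -[RHS]compm1 -ip compm_sum; apply: eq_bigr => a _.
  rewrite hmE (bigD1 a) //= big1 => [|b ba].
    by rewrite (coord_free _ _ (Bfree V)) eqxx scale1r addr0 compA.
  by rewrite (coord_free _ _ (Bfree V)) eq_sym (negbTE ba) scale0r.
- apply/lfunP => v; rewrite hmE [v in RHS](coord_vbasis (memvf v)) linear_sum.
  apply: eq_bigr => a _; rewrite linearZ /=; congr (_ *: _).
  rewrite comp_summ (bigD1 a) //= big1 => [|b ba].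
    by rewrite -compA pi eqxx compm1 addr0.
  by rewrite -compA pi (negbTE ba) compm0.
- apply/lfunP => v; rewrite comp_lfunE postcompE !hmE compm_sum.
  by apply: eq_bigr => a _; rewrite compmZ compA.
Qed.

End Progenerator.

(** * The Nakayama functor *)

Section Coend.
Variables (k : fieldType) (C : lincat k).
Implicit Types X Y Z M W : C.

Section Copowers.
Variable P : copowers C.

Lemma cpw_homP (V : vectType k) M N (x y : Hom (cpw P V M) N) :
  (forall v, cpw_hom x v = cpw_hom y v) -> x = y.
Proof.
move=> xy; rewrite -[x](cpw_homK (c := P)) -[y](cpw_homK (c := P)).
by congr cpw_inv; apply/lfunP.
Qed.

Lemma cpw_hom_comp (V : vectType k) M N N' (g : Hom N N')
    (h : Hom (cpw P V M) N) v : cpw_hom (g \o h) v = g \o cpw_hom h v.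
Proof. by rewrite cpw_nat comp_lfunE postcompE. Qed.

Lemma cpw_hom_cpwm (V V' : vectType k) M M' N (a : 'Hom(V, V')) (f : Hom M M')
    (x : Hom (cpw P V' M') N) v :
  cpw_hom (x \o cpwm P a f) v = cpw_hom x (a v) \o f.
Proof.
rewrite cpw_hom_comp /cpwm cpw_invK !comp_lfunE precompE compA.
by rewrite -cpw_hom_comp compm1.
Qed.

End Copowers.

Lemma transpE (V V' : vectType k) (a : 'Hom(V, V')) (phi : dualv V') :
  transp a phi = (phi \o a)%VF.
Proof.
rewrite /transp linfun_linE // => c f g.
by rewrite comp_lfunDl -comp_lfunZl.
Qed.

(** Dinaturality read on single vectors phi of the dual space, which removes the copowers. *)
Definition dnat M W (j : forall Z, 'Hom(dualv (Hom M Z), Hom Z W)) : Prop :=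
  forall Z Z' (h : Hom Z Z') (phi : dualv (Hom M Z')),
    j Z' phi \o h = j Z (phi \o postcomp M h)%VF.

Definition is_coend M W (i : forall Z, 'Hom(dualv (Hom M Z), Hom Z W)) : Prop :=
  dnat i /\ forall W' (j : forall Z, 'Hom(dualv (Hom M Z), Hom Z W')),
    dnat j -> exists! u : Hom W W', forall Z phi, u \o i Z phi = j Z phi.

Lemma is_coend_inj M W W' (i : forall Z, 'Hom(dualv (Hom M Z), Hom Z W))
    (u v : Hom W W') :
  is_coend i -> (forall Z phi, u \o i Z phi = v \o i Z phi) -> u = v.
Proof.
move=> [iN iU] uv.
have [|w [_ wU]] := iU W' (fun Z => (postcomp Z u \o i Z)%VF).
  by move=> Z Z' h phi; rewrite !comp_lfunE !postcompE -compA iN.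
by rewrite -(wU u) ?(wU v) // => Z phi; rewrite comp_lfunE postcompE.
Qed.

Section Nakayama.
Variable N : nakayama C.

(* nki Z M phi is the component of the universal dinatural i_{Z,M} at the vector
   phi of Hom(M, Z)^*. *)
Definition nki Z M : 'Hom(dualv (Hom M Z), Hom Z (N M)) := cpw_hom (nk_i N Z M).

Lemma nki_nat M Z Z' (h : Hom Z Z') (phi : dualv (Hom M Z')) :
  nki Z' M phi \o h = nki Z M (phi \o postcomp M h)%VF.
Proof.
have := @nk_dinat _ _ N M _ _ h => /(congr1 (fun x => cpw_hom x phi)).
by rewrite !cpw_hom_cpwm id_lfunE compm1 transpE.
Qed.

Lemma nki_coend M : is_coend (fun Z => nki Z M).
Proof.
split=> [Z Z' h phi | W j jN]; first exact: nki_nat.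
have [|u [uE uU]] := @nk_univ _ _ N M W (fun Z => cpw_inv (nk_cpw N) (j Z)).
  move=> Z Z' h; apply: cpw_homP => phi.
  by rewrite !cpw_hom_cpwm !cpw_invK id_lfunE compm1 transpE jN.
exists u; split=> [Z phi | v vE].
  by rewrite /nki -cpw_hom_comp uE cpw_invK.
apply: uU => Z; apply: cpw_homP => phi.
by rewrite cpw_hom_comp [_ \o _]vE cpw_invK.
Qed.

Lemma nki_inj M W (u v : Hom (N M) W) :
  (forall Z phi, u \o nki Z M phi = v \o nki Z M phi) -> u = v.
Proof. exact: is_coend_inj (nki_coend M). Qed.

End Nakayama.

Section Existence.
Variables (G : C) (PG : is_progen G).

(** [W] is chosen so that [T] identifies Hom(G, W) with the dual of Hom(M, G), and [i Z phi] is
    determined by its composites with maps z : G -> Z. A dinatural family [j] is determined by its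
    component at G, so u must send x to [j G (T x)]. *)
Lemma pg_coend M : exists W (i : forall Z, 'Hom(dualv (Hom M Z), Hom Z W)),
  is_coend i /\ bijective (i G).
Proof.
pose act (e : Hom G G) (v : dualv (Hom M G)) : dualv (Hom M G) :=
  (v \o postcomp M e)%VF.
have [||||W [T [[T' TK TK'] TE]]] := pg_ess PG (act := act).
- by move=> e c u v; rewrite /act comp_lfunDl -comp_lfunZl.
- move=> v c e e'; rewrite /act; apply/lfunP => m.
  by rewrite add_lfunE scale_lfunE !comp_lfunE !postcompE comp_linl linearP.
- by move=> v; apply/lfunP => m; rewrite comp_lfunE postcompE comp1m.
- move=> e e' v; apply/lfunP => m.
  by rewrite !comp_lfunE !postcompE compA.
have T'L : linear T'.
  by move=> c x y; rewrite -[RHS]TK linearP /= !TK'.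
have iP Z (phi : dualv (Hom M Z)) : exists h : Hom Z W,
    forall z : Hom G Z, T' (phi \o postcomp M z)%VF = h \o z.
  apply: (pg_full PG) => [c x y | x e].
    rewrite -T'L; congr T'; apply/lfunP => m.
    by rewrite add_lfunE scale_lfunE !comp_lfunE !postcompE comp_linl linearP.
  rewrite -[RHS]TK TE TK'; congr T'; apply/lfunP => m.
  by rewrite !comp_lfunE !postcompE compA.
pose i0 Z phi := projT1 (cid (iP Z phi)).
have i0E Z (phi : dualv (Hom M Z)) (z : Hom G Z) :
    i0 Z phi \o z = T' (phi \o postcomp M z)%VF.
  by rewrite (projT2 (cid (iP Z phi))).
have i0L Z : linear (i0 Z).
  move=> c p q; apply: (pg_faith PG) => z; rewrite i0E comp_linl !i0E -T'L.
  by rewrite comp_lfunDl -comp_lfunZl.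
pose i Z := linfun (i0 Z).
have iE Z (phi : dualv (Hom M Z)) (z : Hom G Z) :
    i Z phi \o z = T' (phi \o postcomp M z)%VF.
  by rewrite (linfun_linE (i0L Z)) i0E.
have post1 : postcomp M (idm G) = \1%VF.
  by apply/lfunP => m; rewrite postcompE comp1m id_lfunE.
have iGE phi : i G phi = T' phi.
  by rewrite -[LHS]compm1 iE post1 comp_lfun1r.
exists W, i; split; last first.
  by exists T => [phi | x]; rewrite iGE ?TK' ?TK.
split=> [Z Z' h phi | W' j jN].
  apply: (pg_faith PG) => z; rewrite iE -compA iE; congr T'.
  by apply/lfunP => m; rewrite !comp_lfunE !postcompE compA.
have [||u uE] := pg_full PG (T := fun x => j G (T x)).
- by move=> c x y; rewrite !linearP.
- by move=> x e; rewrite TE jN.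
exists u; split=> [Z phi | v vE].
  by apply: (pg_faith PG) => z; rewrite -compA iE -uE TK' jN.
by apply: (pg_faith PG) => x; rewrite -uE -vE iGE TK.
Qed.

Lemma pg_nakayama : exists N : nakayama C, True.
Proof.
have [P _] := pg_copowers PG.
pose dat M := cid (pg_coend M); pose W M := projT1 (dat M).
pose dati M := cid (projT2 (dat M)).
pose i M : forall Z, 'Hom(dualv (Hom M Z), Hom Z (W M)) := projT1 (dati M).
have iC M : is_coend (i M) by have [] := projT2 (dati M).
pose I Z M : Hom (cpw P (dualv (Hom M Z)) Z) (W M) := cpw_inv P (i M Z).
have ID M : dinatural (fun Z => I Z M).
  move=> Z Z' h; apply: cpw_homP => phi.
  rewrite !cpw_hom_cpwm !cpw_invK id_lfunE compm1 transpE.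
  exact: (proj1 (iC M)).
suff IU M W' (j : forall Z, Hom (cpw P (dualv (Hom M Z)) Z) W') :
    dinatural j -> exists! u : Hom (W M) W', forall Z, u \o I Z M = j Z.
  by exists (Nakayama ID IU).
move=> jD; have [|u [uE uU]] := proj2 (iC M) W' (fun Z => cpw_hom (j Z)).
  move=> Z Z' h phi; have /(congr1 (fun x => cpw_hom x phi)) := jD _ _ h.
  by rewrite !cpw_hom_cpwm id_lfunE compm1 transpE.
exists u; split=> [Z | v vE].
  by apply: cpw_homP => phi; rewrite cpw_hom_comp cpw_invK uE.
by apply: uU => Z phi; rewrite -vE cpw_hom_comp cpw_invK.
Qed.

Variable N : nakayama C.

(** Coends of the same functor are isomorphic, so bijectivity at G passes from the constructed coend
    to an arbitrary [N]. *)
Lemma nki_progen_bij M : bijective (nki N G M).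
Proof.
have [W [i [iC [i' iK iK']]]] := pg_coend M.
have [u [uE _]] := proj2 (nki_coend N M) _ _ (proj1 iC).
have [v [vE _]] := proj2 iC _ _ (proj1 (nki_coend N M)).
have vu : v \o u = idm _.
  by apply: nki_inj => Z phi; rewrite -compA uE vE comp1m.
exists (fun x => i' (u \o x)) => [phi | x]; first by rewrite uE iK.
by rewrite -vE iK' compA vu comp1m.
Qed.

(** By the dual basis, g is the sum of the (g z_a) m_a, so phi is determined by the functionals
    phi(g z_a -) on Hom(P, G), where bijectivity is known. *)
Lemma nki_proj_inj P Z : projective P -> injective (nki N Z P).
Proof.
move=> PP; have [n [z [m zm]]] := pg_proj_decomp PG PP.
suff i0 phi : nki N Z P phi = 0 -> phi = 0.
  move=> p q pq; apply/eqP; rewrite -subr_eq0; apply/eqP/i0.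
  by rewrite linearB /= pq subrr.
move=> iphi; apply/lfunP => g; rewrite zero_lfunE -[g]compm1 -zm compm_sum.
rewrite linear_sum big1 // => a _; rewrite compA.
have : nki N G P (phi \o postcomp P (g \o z a)%cat)%VF = 0.
  by rewrite -nki_nat iphi comp0m.
rewrite -(linear0 (nki N G P)) => /(bij_inj (nki_progen_bij P))/lfunP/(_ (m a)).
by rewrite comp_lfunE postcompE zero_lfunE.
Qed.

Lemma nki_proj_surj P Z (h : Hom Z (N P)) :
  projective P -> exists phi, nki N Z P phi = h.
Proof.
move=> PP; have [n [z [m zm]]] := pg_proj_decomp PG PP.
have [psi iK psiK] := nki_progen_bij P.
have psiL : linear psi.
  by move=> c x y; rewrite -[RHS]iK linearP /= !psiK.
have psiN x (e : Hom G G) : psi (x \o e) = (psi x \o postcomp P e)%VF.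
  by rewrite -[RHS]iK -nki_nat psiK.
(* The only possible value: a preimage phi of h satisfies phi(g z_a -) = psi(h g z_a), and these are
   summed at the m_a. *)
pose f (g : Hom P Z) : k^o := \sum_a psi (h \o g \o z a) (m a).
have fL : linear f.
  move=> c x y; rewrite /f scaler_sumr -big_split; apply: eq_bigr => a _ /=.
  by rewrite comp_linr comp_linl psiL add_lfunE scale_lfunE.
exists (linfun f); apply: (pg_faith PG) => x; rewrite nki_nat -[RHS]psiK.
congr (nki N G P _); apply/lfunP => g.
rewrite comp_lfunE postcompE (linfun_linE fL) /f -[g in RHS]compm1 -zm.
rewrite compm_sum linear_sum; apply: eq_bigr => a _.
by rewrite compA -compA psiN comp_lfunE postcompE compA.
Qed.

End Existence.
End Coend.

(** * Adjoint endofunctors and their effect on the coend *)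

Section Adjunction.
Variables (k : fieldType) (C : lincat k).

Record endofun := Endofun {
  eo :> C -> C;
  em : forall X Y : C, Hom X Y -> Hom (eo X) (eo Y);
  em_id : forall X : C, em (idm X) = idm (eo X);
  em_comp : forall (X Y Z : C) (g : Hom Y Z) (f : Hom X Y),
    em (g \o f) = em g \o em f;
  em_lin : forall X Y : C, linear (@em X Y)
}.

Record adjunction (F H : endofun) := Adjunction {
  cur : forall M W : C, Hom (F M) W -> Hom M (H W);
  unc : forall M W : C, Hom M (H W) -> Hom (F M) W;
  curK : forall (M W : C) (f : Hom (F M) W), unc (cur f) = f;
  uncK : forall (M W : C) (g : Hom M (H W)), cur (unc g) = g;
  cur_lin : forall M W : C, linear (@cur M W);
  cur_natl : forall (M M' W : C) (f : Hom (F M) W) (h : Hom M' M),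
    cur (f \o em F h) = cur f \o h;
  cur_natr : forall (M W W' : C) (f : Hom (F M) W) (h : Hom W W'),
    cur (h \o f) = em H h \o cur f
}.

Variables (F H : endofun) (a : adjunction F H).
Implicit Types M W : C.

Lemma cur_inj M W : injective (@cur F H a M W).
Proof. exact: can_inj (curK a (M := M) (W := W)). Qed.

Lemma unc_lin M W : linear (@unc F H a M W).
Proof. by move=> c f g; apply: cur_inj; rewrite cur_lin !uncK. Qed.

Lemma unc_natl M M' W (g : Hom M (H W)) (h : Hom M' M) :
  unc a (g \o h) = unc a g \o em F h.
Proof. by apply: cur_inj; rewrite cur_natl !uncK. Qed.

Lemma unc_natr M W W' (g : Hom M (H W)) (h : Hom W W') :
  unc a (em H h \o g) = h \o unc a g.
Proof. by apply: cur_inj; rewrite cur_natr !uncK. Qed.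

Lemma unc_counit M W (g : Hom M (H W)) :
  unc a g = unc a (idm (H W)) \o em F g.
Proof. by rewrite -unc_natl comp1m. Qed.

Lemma cur_unit M W (f : Hom (F M) W) : cur a f = em H f \o cur a (idm (F M)).
Proof. by rewrite -cur_natr compm1. Qed.

End Adjunction.

Section NakayamaFunctor.
Variables (k : fieldType) (C : lincat k) (N : nakayama C).
Implicit Types X Y Z M W : C.

Lemma nmor_exists M M' (f : Hom M M') : exists u : Hom (N M) (N M'),
  forall Z phi, u \o nki N Z M phi = nki N Z M' (phi \o precomp Z f)%VF.
Proof.
have jE Z phi : linfun (fun phi : dualv (Hom M Z) =>
    nki N Z M' (phi \o precomp Z f)%VF) phi =
    nki N Z M' (phi \o precomp Z f)%VF.
  rewrite linfun_linE // => c p q.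
  by rewrite comp_lfunDl -comp_lfunZl linearP.
have [|u [uE _]] := proj2 (nki_coend N M) _ (fun Z => linfun
    (fun phi : dualv (Hom M Z) => nki N Z M' (phi \o precomp Z f)%VF)).
  move=> Z Z' h phi; rewrite !jE nki_nat; congr (nki N _ _ _).
  apply/lfunP => m; rewrite !comp_lfunE !postcompE !precompE.
  by rewrite ?postcompE compA.
by exists u => Z phi; rewrite uE jE.
Qed.

Definition nmor M M' (f : Hom M M') : Hom (N M) (N M') :=
  projT1 (cid (nmor_exists f)).

Lemma nmorE M M' (f : Hom M M') Z phi :
  nmor f \o nki N Z M phi = nki N Z M' (phi \o precomp Z f)%VF.
Proof. exact: (projT2 (cid (nmor_exists f))). Qed.

Lemma nmor_id M : nmor (idm M) = idm (N M).
Proof.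
apply: nki_inj => Z phi; rewrite nmorE comp1m; congr (nki N _ _ _).
by apply/lfunP => m; rewrite comp_lfunE precompE compm1.
Qed.

Lemma nmor_comp M M' M'' (g : Hom M' M'') (f : Hom M M') :
  nmor (g \o f) = nmor g \o nmor f.
Proof.
apply: nki_inj => Z phi; rewrite -compA !nmorE; congr (nki N _ _ _).
by apply/lfunP => m; rewrite !comp_lfunE !precompE compA.
Qed.

Lemma nmor_eqhom M M' (e : M = M') : nmor (eqhom e) = eqhom (f_equal N e).
Proof. by case: M' / e; rewrite /= nmor_id. Qed.

Section DoubleAdjunction.
Variables T T1 T2 T3 : endofun C.
Variables (a1 : adjunction T T1) (a2 : adjunction T1 T2).
Variable (a3 : adjunction T2 T3).

(* The abstract form of the closing operators cl^r and cl^l. *)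
Definition closing M Z (f : Hom (T M) (T2 Z)) : Hom M Z :=
  unc a2 (idm (T2 Z)) \o cur a1 f.

Lemma closing_lin M Z : linear (@closing M Z).
Proof. by move=> c f g; rewrite /closing cur_lin comp_linr. Qed.

Lemma closing_natr M Z Z' (h : Hom Z Z') (f : Hom (T M) (T2 Z)) :
  closing (em T2 h \o f) = h \o closing f.
Proof.
rewrite /closing cur_natr !compA -unc_counit; congr (_ \o _).
by rewrite -[em T2 h]compm1 unc_natr.
Qed.

Lemma closing_natl M M' Z (f : Hom (T M) (T2 Z)) (h : Hom M' M) :
  closing (f \o em T h) = closing f \o h.
Proof. by rewrite /closing cur_natl compA. Qed.

(** Together with [closing_unc], this is what makes the two maps of [nki_adjunction] mutually
    inverse. *)
Lemma unc_closing M W (f : Hom (T M) W) :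
  unc a1 (closing (cur a2 (idm (T1 W)) \o f)) = f.
Proof. by rewrite /closing cur_natr compA -unc_counit curK comp1m curK. Qed.

Lemma closing_unc M Z (g : Hom M (T1 (T2 Z))) :
  closing (unc a1 g) = unc a2 (idm (T2 Z)) \o g.
Proof. by rewrite /closing uncK. Qed.

(** A left adjoint such as [T2] keeps the universal maps of the coend jointly epimorphic. *)
Lemma nki_functor_inj M W (u v : Hom (T2 (N M)) W) :
  (forall Z phi, u \o em T2 (nki N Z M phi) = v \o em T2 (nki N Z M phi)) ->
  u = v.
Proof.
move=> uv; apply: (@cur_inj _ _ _ _ a3).
by apply: nki_inj => Z phi; rewrite -!cur_natl uv.
Qed.

(** Maps out of T2(N(M)) correspond, by transposition along [a3], to maps out of the coend N(M);
    this defines Psi from a dinatural family. The inverse is a map out of the coend N(T(M)). *)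
Lemma nki_adjunction M : exists (Psi : Hom (T2 (N M)) (N (T M)))
    (PsiV : Hom (N (T M)) (T2 (N M))),
  [/\ PsiV \o Psi = idm _, Psi \o PsiV = idm _ &
    forall Z phi, Psi \o em T2 (nki N Z M phi) =
      nki N (T2 Z) (T M) (phi \o linfun (@closing M Z))%VF].
Proof.
pose j0 Z (phi : dualv (Hom M Z)) : Hom Z (T3 (N (T M))) :=
  cur a3 (nki N (T2 Z) (T M) (phi \o linfun (@closing M Z))%VF).
have jL Z : linear (@j0 Z).
  by move=> c p q; rewrite /j0 comp_lfunDl -comp_lfunZl linearP cur_lin.
have clE Z (f : Hom (T M) (T2 Z)) : linfun (@closing M Z) f = closing f.
  by rewrite (linfun_linE (@closing_lin _ _)).
have uncE W (f : Hom M (T1 W)) : linfun (@unc _ _ _ _ a1 M W) f = unc a1 f.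
  by rewrite (linfun_linE (@unc_lin _ _ _ _ a1 _ _)).
have [|P [PE _]] := proj2 (nki_coend N M) _ (fun Z => linfun (@j0 Z)).
  move=> Z Z' h phi; rewrite !(linfun_linE (jL _)) /j0 -cur_natl nki_nat.
  congr (cur a3 (nki N _ _ _)); apply/lfunP => m.
  by rewrite !comp_lfunE !clE !postcompE closing_natr.
have PsiE Z phi : unc a3 P \o em T2 (nki N Z M phi) =
    nki N (T2 Z) (T M) (phi \o linfun (@closing M Z))%VF.
  rewrite -unc_natl PE (linfun_linE (jL _)) /j0.
  by rewrite curK.
(* The family for the inverse: phi on Hom(T M, W) is moved by [a1] to Hom(M, T1 W), the coend map is
   taken at T1 W, and the unit W -> T2 (T1 W) brings the source back to W. *)
pose l0 W (phi : dualv (Hom (T M) W)) : Hom W (T2 (N M)) :=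
  em T2 (nki N (T1 W) M (phi \o linfun (@unc _ _ _ _ a1 M W))%VF)
    \o cur a2 (idm (T1 W)).
have lL W : linear (@l0 W).
  move=> c p q; rewrite /l0 comp_lfunDl -comp_lfunZl linearP em_lin.
  by rewrite comp_linl.
have [|Q [QE _]] := proj2 (nki_coend N (T M)) _ (fun Z => linfun (@l0 Z)).
  move=> Z Z' h phi; rewrite !(linfun_linE (lL _)) /l0 -compA -cur_natl comp1m.
  rewrite (cur_unit a2 (em T1 h)) compA -em_comp nki_nat.
  congr (em T2 (nki N _ _ _) \o _); apply/lfunP => m.
  by rewrite !comp_lfunE !uncE !postcompE unc_natr.
have {}QE Z phi : Q \o nki N Z (T M) phi = l0 Z phi.
  by rewrite QE (linfun_linE (lL _)).
exists (unc a3 P), Q; split=> //.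
  apply: nki_functor_inj => Z phi; rewrite -compA PsiE QE /l0 comp1m.
  rewrite -[RHS]compm1 -(uncK a2 (idm (T2 Z))) [cur a2 (unc _ _)]cur_unit.
  rewrite compA -em_comp nki_nat.
  congr (em T2 (nki N _ _ _) \o _); apply/lfunP => g.
  by rewrite !comp_lfunE uncE clE postcompE closing_unc.
apply: nki_inj => W phi; rewrite -compA QE /l0 comp1m compA PsiE nki_nat.
congr (nki N _ _ _); apply/lfunP => f.
by rewrite !comp_lfunE postcompE clE uncE unc_closing.
Qed.

End DoubleAdjunction.
End NakayamaFunctor.

(** * Strict tensor calculus *)

(* Morphisms with varying source and target, composed whenever the objects
   agree.  In this calculus the casts [eqhom] become identities, and strict
   associativity and unitality are plain equations. *)
Section Arrows.
Variables (k : fieldType) (C : smcat k).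
Implicit Types X Y Z M N W : C.

Record arr := Arr { adom : C; acod : C; ahom : Hom adom acod }.
Definition parr := option arr.
Implicit Types p q r : parr.

Definition ar X Y (f : Hom X Y) : parr := Some (Arr f).
Definition pdom p : option C := omap adom p.
Definition pcod p : option C := omap acod p.

Definition pcomp p q : parr :=
  match p, q with
  | Some g, Some f =>
      match pselect (acod f = adom g) with
      | left e => Some (Arr (ahom g \o eqhom e \o ahom f))
      | right _ => None
      end
  | _, _ => None
  end.

Definition ptens p q : parr :=
  match p, q with
  | Some f, Some g => Some (Arr (ahom f ⊗₁ ahom g))
  | _, _ => None
  end.

Notation "p ∙ q" := (pcomp p q) (at level 50, left associativity).
Notation "p ⊠ q" := (ptens p q) (at level 40, left associativity).
Notation "'𝟙' X" := (ar (idm X)) (at level 8, X at level 2, format "'𝟙' X").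

(** An arrow with ends X and Y is recovered up to casts, and a cast from an object to itself is the
    identity by proof irrelevance. *)
Lemma ar_inj X Y (f g : Hom X Y) : ar f = ar g -> f = g.
Proof.
move=> fg.
have cast (a : arr) (e1 : adom a = X) (e2 : acod a = Y) : ar f = Some a ->
    f = eqhom e2 \o ahom a \o eqhom (esym e1).
  case=> H; move: e1 e2; rewrite -H /= => e1 e2.
  by rewrite !eqhom_id comp1m compm1.
by have := cast (Arr g) erefl erefl fg; rewrite /= comp1m compm1.
Qed.

Lemma ar_comp X Y Z (g : Hom Y Z) (f : Hom X Y) : ar (g \o f) = ar g ∙ ar f.
Proof.
rewrite /pcomp /=; case: pselect => [e | []//].
by rewrite eqhom_id compm1.
Qed.

Lemma ar_tens X X' Y Y' (f : Hom X X') (g : Hom Y Y') :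
  ar (f ⊗₁ g) = ar f ⊠ ar g.
Proof. by []. Qed.

Lemma ar_eqhoml X Y Z (e : Y = Z) (f : Hom X Y) : ar (eqhom e \o f) = ar f.
Proof. by case: Z / e; rewrite comp1m. Qed.

Lemma ar_eqhomr X Y Z (e : X = Y) (f : Hom Y Z) : ar (f \o eqhom e) = ar f.
Proof. by case: Y / e f => f; rewrite compm1. Qed.

Lemma pcompA p q r : p ∙ (q ∙ r) = (p ∙ q) ∙ r.
Proof.
case: p q r => [[X Y h]|] [[X' Y' g]|] [[X'' Y'' f]|] //=; last first.
- by case: pselect.
- case: pselect => [e | ne] /=; case: pselect => [e' | ne'] //=.
    by case: pselect => [e2 | //]; rewrite (Prop_irrelevance e2 e) !compA.
  by case: pselect.
Qed.

Lemma pcomp1 X Y (f : Hom X Y) : ar f ∙ 𝟙X = ar f.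
Proof. by rewrite -ar_comp compm1. Qed.

Lemma p1comp X Y (f : Hom X Y) : 𝟙Y ∙ ar f = ar f.
Proof. by rewrite -ar_comp comp1m. Qed.

Lemma ar_id X Y : 𝟙X ⊠ 𝟙Y = 𝟙(X ⊗ Y).
Proof. by rewrite -ar_tens tensm_id. Qed.

Lemma ptensA p q r : p ⊠ q ⊠ r = p ⊠ (q ⊠ r).
Proof.
case: p q r => [[X Y f]|] [[X' Y' g]|] [[X'' Y'' h]|] //=.
rewrite -[LHS]/(ar (f ⊗₁ g ⊗₁ h)) -[RHS]/(ar (f ⊗₁ (g ⊗₁ h))).
by rewrite -(ar_eqhoml (tensA _ _ _)) tensmA ar_eqhomr.
Qed.

Lemma p1tens p : 𝟙one ⊠ p = p.
Proof.
case: p => [[X Y f]|] //; rewrite -[LHS]/(ar (idm one ⊗₁ f)) -[RHS]/(ar f).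
by rewrite -(ar_eqhoml (tens1o _)) tensm1l ar_eqhomr.
Qed.

Lemma ptens1 p : p ⊠ 𝟙one = p.
Proof.
case: p => [[X Y f]|] //; rewrite -[LHS]/(ar (f ⊗₁ idm one)) -[RHS]/(ar f).
by rewrite -(ar_eqhoml (tenso1 _)) tensm1r ar_eqhomr.
Qed.

(** Tensor products may coincide without their factors coinciding, so the right side could be
    defined when the left is not; the matching conditions exclude this. *)
Lemma interchange p q p' q' : pcod q = pdom p -> pcod q' = pdom p' ->
  (p ∙ q) ⊠ (p' ∙ q') = (p ⊠ p') ∙ (q ⊠ q').
Proof.
case: p q p' q' => [[X Y f]|] [[X' Y' g]|] [[U V f']|] [[U' V' g']|];
  try by move=> //=; case: pselect.
rewrite /pcod /pdom => -[e] [e']; simpl in e, e'; subst X U.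
rewrite -[Some (Arr f)]/(ar f) -[Some (Arr g)]/(ar g) -[Some (Arr f')]/(ar f').
rewrite -[Some (Arr g')]/(ar g') -!ar_comp -!ar_tens tensm_comp.
by rewrite ar_comp.
Qed.

Lemma pwhiskl W p q : pcod q = pdom p -> 𝟙W ⊠ (p ∙ q) = (𝟙W ⊠ p) ∙ (𝟙W ⊠ q).
Proof. by move=> e; rewrite -interchange // p1comp. Qed.

Lemma pwhiskr W p q : pcod q = pdom p -> (p ∙ q) ⊠ 𝟙W = (p ⊠ 𝟙W) ∙ (q ⊠ 𝟙W).
Proof. by move=> e; rewrite -interchange // p1comp. Qed.

Lemma pslide X X' Y Y' (f : Hom X X') (g : Hom Y Y') :
  (ar f ⊠ 𝟙Y') ∙ (𝟙X ⊠ ar g) = (𝟙X' ⊠ ar g) ∙ (ar f ⊠ 𝟙Y).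
Proof. by rewrite -!ar_tens -!ar_comp tensm_split tensm_split'. Qed.

End Arrows.
Notation "p ∙ q" := (pcomp p q) (at level 50, left associativity) : cat_scope.
Notation "p ⊠ q" := (ptens p q) (at level 40, left associativity) : cat_scope.
Notation "'𝟙' X" := (ar (idm X)) 
  (at level 8, X at level 2, format "'𝟙' X") : cat_scope.

(** * Tensoring with an object as an adjoint functor *)

Section TensorAdjunctions.
Variables (k : fieldType) (C : smcat k) (D : rigid C).
Implicit Types X Y Z M N W : C.
Notation ev := (ev D).
Notation coev := (coev D).
Notation ev' := (ev' D).
Notation coev' := (coev' D).

Lemma ar_curr X M N (f : Hom (M ⊗ X) N) :
  ar (curr D f) = (ar f ⊠ 𝟙(ld D X)) ∙ (𝟙M ⊠ ar (coev X)).
Proof. by rewrite /curr /runV /ascV ar_eqhomr ar_comp ar_eqhomr. Qed.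

Lemma ar_uncurr X M N (g : Hom M (N ⊗ ld D X)) :
  ar (uncurr g) = (𝟙N ⊠ ar (ev X)) ∙ (ar g ⊠ 𝟙X).
Proof. by rewrite /uncurr /run /asc ar_comp ar_eqhomr ar_eqhoml. Qed.

Lemma ar_curl X M N (f : Hom (X ⊗ M) N) :
  ar (curl D f) = (𝟙(rd D X) ⊠ ar f) ∙ (ar (coev' X) ⊠ 𝟙M).
Proof. by rewrite /curl /lunV /asc ar_eqhomr ar_comp ar_eqhomr. Qed.

Lemma ar_uncurl X M N (g : Hom M (rd D X ⊗ N)) :
  ar (uncurl g) = (ar (ev' X) ⊠ 𝟙N) ∙ (𝟙X ⊠ ar g).
Proof. by rewrite /uncurl /lun /ascV ar_comp ar_eqhomr ar_eqhoml. Qed.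

Lemma zigzag_ev X : (𝟙X ⊠ ar (ev X)) ∙ (ar (coev X) ⊠ 𝟙X) = 𝟙X.
Proof.
rewrite -[I in _ = ar I](ev_coev D X) /run /asc /lunV ar_eqhomr ar_comp.
by rewrite ar_eqhomr ar_eqhoml.
Qed.

Lemma zigzag_coev X :
  (ar (ev X) ⊠ 𝟙(ld D X)) ∙ (𝟙(ld D X) ⊠ ar (coev X)) = 𝟙(ld D X).
Proof.
rewrite -[I in _ = ar I](coev_ev D X) /lun /ascV /runV ar_eqhomr ar_comp.
by rewrite ar_eqhomr ar_eqhoml.
Qed.

Lemma zigzag_coev' X :
  (𝟙(rd D X) ⊠ ar (ev' X)) ∙ (ar (coev' X) ⊠ 𝟙(rd D X)) = 𝟙(rd D X).
Proof.
rewrite -[I in _ = ar I](coev_ev' D X) /run /asc /lunV ar_eqhomr ar_comp.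
by rewrite ar_eqhomr ar_eqhoml.
Qed.

(** Coevaluation slides past g, and a zigzag identity removes it. *)
Lemma uncurrK X M N (g : Hom M (N ⊗ ld D X)) : curr D (uncurr g) = g.
Proof.
apply: ar_inj; rewrite ar_curr ar_uncurr.
rewrite pwhiskr; last by rewrite /= tensA.
rewrite -pcompA ptensA (ptensA (ar g)) ar_id pslide pcompA.
rewrite -ar_id !ptensA -pwhiskl; last by rewrite /= tensA.
by rewrite zigzag_coev ar_id ptens1 p1comp.
Qed.

Lemma uncurlK X M N (g : Hom M (rd D X ⊗ N)) : curl D (uncurl g) = g.
Proof.
apply: ar_inj; rewrite ar_curl ar_uncurl.
rewrite pwhiskl; last by rewrite /= tensA.
rewrite -pcompA -!ptensA ar_id -pslide pcompA.
rewrite -ar_id -!ptensA -pwhiskr; last by rewrite /= tensA.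
by rewrite zigzag_coev' ar_id p1tens p1comp.
Qed.

Definition tensr X : endofun C.
Proof.
apply: (@Endofun _ C (fun M => M ⊗ X) (fun _ _ f => f ⊗₁ idm X)) => *.
- exact: tensm_id.
- exact: compl_tensm.
- exact: tensm_linl.
Defined.

Definition tensl X : endofun C.
Proof.
apply: (@Endofun _ C (fun M => X ⊗ M) (fun _ _ f => idm X ⊗₁ f)) => *.
- exact: tensm_id.
- exact: compr_tensm.
- exact: tensm_linr.
Defined.

Lemma curr_natr X M N N' (f : Hom (M ⊗ X) N) (h : Hom N N') :
  curr D (h \o f) = (h ⊗₁ idm _) \o curr D f.
Proof. by rewrite /curr compl_tensm !compA. Qed.

Lemma curl_natr X M N N' (f : Hom (X ⊗ M) N) (h : Hom N N') :
  curl D (h \o f) = (idm _ ⊗₁ h) \o curl D f.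
Proof. by rewrite /curl compr_tensm !compA. Qed.

Lemma curr_lin X M N : linear (@curr k C D X M N).
Proof. by move=> c f g; rewrite /curr tensm_linl !comp_linl. Qed.

Lemma curl_lin X M N : linear (@curl k C D X M N).
Proof. by move=> c f g; rewrite /curl tensm_linr !comp_linl. Qed.

Definition adjr X : adjunction (tensr X) (tensr (ld D X)) :=
  @Adjunction _ _ (tensr X) (tensr (ld D X)) (@curr k C D X) (@uncurr k C D X)
    (@currK k C D X) (@uncurrK X) (@curr_lin X) (@curr_natl k C D X)
    (@curr_natr X).

Definition adjl X : adjunction (tensl X) (tensl (rd D X)) :=
  @Adjunction _ _ (tensl X) (tensl (rd D X)) (@curl k C D X) (@uncurl k C D X)
    (@curlK k C D X) (@uncurlK X) (@curl_lin X) (@curl_natl k C D X)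
    (@curl_natr X).

End TensorAdjunctions.

Section Closing.
Variables (k : fieldType) (C : ftcat k).
Implicit Types X Y Z M N W : C.
Notation D := (ft_rigid C).

(** Currying uses the coevaluation of X, and the counit of the second adjunction is the evaluation
    of [X^L]. *)
Lemma clr_closing M N X (f : Hom (M ⊗ X) (N ⊗ X^LL)) :
  clr f = closing (adjr D X) (adjr D X^L) f.
Proof.
rewrite /closing /= /clr /uncurr /curr tensm_id compm1.
by rewrite !compA.
Qed.

Lemma cll_closing X M N (f : Hom (X ⊗ M) (X^RR ⊗ N)) :
  cll f = closing (adjl D X) (adjl D X^R) f.
Proof.
rewrite /closing /= /cll /uncurl /curl tensm_id compm1.
by rewrite !compA.
Qed.

End Closing.

(** * Eigenvectors, Schur's lemma and dimension counts *)

Import VectorInternalTheory.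

Lemma lfun_eigenvector (k : closedFieldType) (V : vectType k) (f : 'Hom(V, V)) :
  (exists v : V, v != 0) -> exists (a : k) (v : V), v != 0 /\ f v = a *: v.
Proof.
move=> [w w0]; pose n := dim V.
have n0 : n != 0.
  apply: contra w0 => /eqP n0; rewrite -memv0.
  suff -> : (0 = fullv :> {vspace V})%VS by rewrite memvf.
  by apply/esym/eqP; rewrite -dimv_eq0 dimvf -/n n0.
pose g (u : 'rV[k]_n) : 'rV[k]_n := v2r (f (@r2v k V u)).
have gL : linear g by move=> c x y; rewrite /g !linearP.
pose LM := GRing.isLinear.Build _ _ _ _ _ gL.
pose gl : {linear 'rV[k]_n -> 'rV[k]_n} := HB.pack g LM.
(* The size of the characteristic polynomial is n + 1, so it is not constant once n is non-zero and
   has a root in [k]. *)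
have /closed_rootP[a] : size (char_poly (lin1_mx gl)) != 1.
  by rewrite size_char_poly eqSS.
rewrite -eigenvalue_root_char => /eigenvalueP[u uE u0].
exists a, (@r2v k V u); split.
  by apply: contra u0 => /eqP/(congr1 (@v2r k V)); rewrite r2vK linear0 => ->.
by rewrite -linearZ -uE mul_rV_lin1 /= /g v2rK.
Qed.

Section SimpleEnd.
Variables (k : closedFieldType) (C : lincat k) (G : C) (PG : is_progen G).

(** Schur's lemma: f has an eigenvector x in Hom(G, X), so f - c id kills x and is not mono; on a
    simple object it must vanish. *)
Lemma simple_End (X : C) (f : Hom X X) :
  simple_obj X -> exists c, f = c *: idm X.
Proof.
move=> Xs; have [c [x [x0 fx]]] : exists (c : k) (x : Hom G X),
    x != 0 /\ postcomp G f x = c *: x.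
  apply: lfun_eigenvector; apply: contrapT => no; apply: (proj1 Xs).
  apply: (pg_eq0 PG) => x; apply: contrapT => x0; apply: no.
  by exists x; apply/eqP.
exists c; apply/eqP; rewrite -subr_eq0; apply/eqP; apply: contrapT => d0.
case/eqP: x0; apply: (mono_eq0 (simple_mono PG Xs d0)).
by rewrite compBm compZm comp1m -postcompE fx subrr.
Qed.

End SimpleEnd.

Lemma lfun_inj_surj (k : fieldType) (U V : vectType k) (f : 'Hom(U, V)) :
  injective f -> dim U = dim V -> forall v, exists u, f u = v.
Proof.
move=> /lker0P/eqP f0 dUV v.
suff /memv_imgP[u _ ->] : v \in limg f by exists u.
suff -> : limg f = fullv by rewrite memvf.
by apply/eqP; rewrite eqEdim subvf dimvf limg_dim_eq ?f0 ?capv0 // dimvf dUV /=.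
Qed.

Lemma dualv_dim (k : fieldType) (V : vectType k) : dim (dualv V) = dim V.
Proof. by rewrite /dualv /dim /= muln1. Qed.

Lemma lfun_bij_dim (k : fieldType) (U V : vectType k) (f : 'Hom(U, V)) :
  bijective f -> dim U = dim V.
Proof.
move=> fB; have f0 : lker f = 0%VS by apply/eqP/lker0P; apply: bij_inj.
have fT : limg f = fullv.
  apply/eqP; rewrite eqEsubv subvf /=; apply/subvP => v _.
  by have [g _ gK] := fB; rewrite -(gK v) memv_img ?memvf.
by rewrite -!dimvf -fT limg_dim_eq ?f0 ?capv0.
Qed.

Lemma dualv_sep (k : fieldType) (V : vectType k) (v : V) :
  (forall phi : dualv V, phi v = 0) -> v = 0.
Proof.
move=> v0; rewrite [v](coord_vbasis (memvf v)) big1 // => i _.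
pose f := coord (vbasis (fullv : {vspace V})) i : V -> k^o.
by have := v0 (linfun f); rewrite (linfun_linE (f := f)) => [|c x y];
  rewrite /f ?linearP // => ->; rewrite scale0r.
Qed.

(** * Psi and Phi *)

Section NakayamaTensor.
Variables (k : fieldType) (C : ftcat k) (N : nakayama C).
Implicit Types X Y Z M W : C.
Notation D := (ft_rigid C).

Lemma clr_lin M Z X : linear (@clr k C M Z X).
Proof. by move=> c f g; rewrite !clr_closing closing_lin. Qed.

Lemma cll_lin X M Z : linear (@cll k C X M Z).
Proof. by move=> c f g; rewrite !cll_closing closing_lin. Qed.

Definition clrv M Z X : 'Hom(Hom (M ⊗ X) (Z ⊗ X^LL), Hom M Z) :=
  linfun (@clr k C M Z X).
Definition cllv X M Z : 'Hom(Hom (X ⊗ M) (X^RR ⊗ Z), Hom M Z) :=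
  linfun (@cll k C X M Z).

Lemma clrvE M Z X f : clrv M Z X f = clr f.
Proof. by rewrite /clrv linfun_linE //; apply: clr_lin. Qed.

Lemma cllvE X M Z f : cllv X M Z f = cll f.
Proof. by rewrite /cllv linfun_linE //; apply: cll_lin. Qed.

Lemma cpw_hom_tensr (V : vectType k) Z Y W
    (x : Hom (cpw (nk_cpw N) V Z ⊗ Y) W) v :
  cpw_hom (x \o cpw_tensr N V Z Y) v =
  x \o (cpw_hom (idm (cpw (nk_cpw N) V Z)) v ⊗₁ idm Y).
Proof.
rewrite cpw_hom_comp /cpw_tensr cpw_invK comp_lfunE linfun_linE //.
exact: tensm_linl.
Qed.

Lemma cpw_hom_tensl (V : vectType k) Y Z W
    (x : Hom (Y ⊗ cpw (nk_cpw N) V Z) W) v :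
  cpw_hom (x \o cpw_tensl N V Y Z) v =
  x \o (idm Y ⊗₁ cpw_hom (idm (cpw (nk_cpw N) V Z)) v).
Proof.
rewrite cpw_hom_comp /cpw_tensl cpw_invK comp_lfunE linfun_linE //.
exact: tensm_linr.
Qed.

Lemma nki_id Z M phi :
  nki N Z M phi = nk_i N Z M \o cpw_hom (idm (cpw (nk_cpw N) _ Z)) phi.
Proof. by rewrite -cpw_hom_comp compm1. Qed.

Section PsiPhi.
Variable S : nakayama_tensor N.

(** The defining equation of Psi at a single functional phi, free of copowers; all later identities
    of Psi are checked through it. *)
Lemma nkPsi_nki M X Z phi :
  nkPsi S M X \o (nki N Z M phi ⊗₁ idm X^LL) =
  nki N (Z ⊗ X^LL) (M ⊗ X) (phi \o clrv M Z X)%VF.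
Proof.
have /(congr1 (fun x => cpw_hom x phi)) := nkPsiE S M X Z.
rewrite cpw_hom_cpwm compm1 transpE cpw_hom_tensr -compA -compl_tensm.
by rewrite -nki_id.
Qed.

Lemma nkPhi_nki X M Z phi :
  nkPhi S X M \o (idm X^RR ⊗₁ nki N Z M phi) =
  nki N (X^RR ⊗ Z) (X ⊗ M) (phi \o cllv X M Z)%VF.
Proof.
have /(congr1 (fun x => cpw_hom x phi)) := nkPhiE S X M Z.
rewrite cpw_hom_cpwm compm1 transpE cpw_hom_tensl -compA -compr_tensm.
by rewrite -nki_id.
Qed.

Lemma nki_tensr_inj M Y W (u v : Hom (N M ⊗ Y^L) W) :
  (forall Z phi, u \o (nki N Z M phi ⊗₁ idm Y^L) =
                 v \o (nki N Z M phi ⊗₁ idm Y^L)) -> u = v.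
Proof. exact: (nki_functor_inj (adjr D Y^L)). Qed.

Lemma nki_tensl_inj M Y W (u v : Hom (Y^R ⊗ N M) W) :
  (forall Z phi, u \o (idm Y^R ⊗₁ nki N Z M phi) =
                 v \o (idm Y^R ⊗₁ nki N Z M phi)) -> u = v.
Proof. exact: (nki_functor_inj (adjl D Y^R)). Qed.

Lemma nkPsi_natl M M' X (f : Hom M M') :
  nmor N (f ⊗₁ idm X) \o nkPsi S M X = nkPsi S M' X \o (nmor N f ⊗₁ idm _).
Proof.
apply: nki_tensr_inj => Z phi.
rewrite -!compA -compl_tensm nmorE !nkPsi_nki nmorE; congr (nki N _ _ _).
apply/lfunP => g; rewrite !comp_lfunE !precompE !clrvE !clr_closing.
by rewrite (closing_natl (adjr D X) (adjr D X^L)).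
Qed.

Lemma nkPhi_natr X M M' (f : Hom M M') :
  nmor N (idm X ⊗₁ f) \o nkPhi S X M = nkPhi S X M' \o (idm _ ⊗₁ nmor N f).
Proof.
apply: nki_tensl_inj => Z phi.
rewrite -!compA -compr_tensm nmorE !nkPhi_nki nmorE; congr (nki N _ _ _).
apply/lfunP => g; rewrite !comp_lfunE !precompE !cllvE !cll_closing.
by rewrite (closing_natl (adjl D X) (adjl D X^R)).
Qed.

End PsiPhi.

(** [nki_adjunction] is applied to the right and the left chain of tensor adjunctions; its formula
    at each phi is the required equation of maps out of a copower. *)
Lemma nakayama_tensor_exists : exists S : nakayama_tensor N, True.
Proof.
have clrvC M Z X : linfun (closing (adjr D X) (adjr D X^L) (M := M) (Z := Z)) =
    clrv M Z X.
  by congr linfun; apply/funext => f; rewrite clr_closing.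
have cllvC X M Z : linfun (closing (adjl D X) (adjl D X^R) (M := M) (Z := Z)) =
    cllv X M Z.
  by congr linfun; apply/funext => f; rewrite cll_closing.
pose Rd M X := cid (nki_adjunction N (adjr D X) (adjr D X^L) (adjr D X^LL) M).
pose RdV M X := cid (projT2 (Rd M X)).
pose Ld X M := cid (nki_adjunction N (adjl D X) (adjl D X^R) (adjl D X^RR) M).
pose LdV X M := cid (projT2 (Ld X M)).
pose Psi M X : Hom (N M ⊗ X^LL) (N (M ⊗ X)) := projT1 (Rd M X).
pose PsiV M X : Hom (N (M ⊗ X)) (N M ⊗ X^LL) := projT1 (RdV M X).
pose Phi X M : Hom (X^RR ⊗ N M) (N (X ⊗ M)) := projT1 (Ld X M).
pose PhiV X M : Hom (N (X ⊗ M)) (X^RR ⊗ N M) := projT1 (LdV X M).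
have PsiK M X : PsiV M X \o Psi M X = idm _ by case: (projT2 (RdV M X)).
have PsiVK M X : Psi M X \o PsiV M X = idm _ by case: (projT2 (RdV M X)).
have PhiK X M : PhiV X M \o Phi X M = idm _ by case: (projT2 (LdV X M)).
have PhiVK X M : Phi X M \o PhiV X M = idm _ by case: (projT2 (LdV X M)).
have PsiE M X Z :
  Psi M X \o (nk_i N Z M ⊗₁ idm X^LL) \o cpw_tensr N _ Z X^LL =
  nk_i N (Z ⊗ X^LL) (M ⊗ X)
    \o cpwm (nk_cpw N) (transp (linfun (@clr k C M Z X))) (idm (Z ⊗ X^LL)).
  apply: cpw_homP => phi.
  rewrite cpw_hom_cpwm compm1 transpE cpw_hom_tensr -compA -compl_tensm.
  rewrite -nki_id -[linfun _]/(clrv M Z X) -clrvC.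
  by have [_ _ ->] := projT2 (RdV M X).
have PhiE X M Z :
  Phi X M \o (idm X^RR ⊗₁ nk_i N Z M) \o cpw_tensl N _ X^RR Z =
  nk_i N (X^RR ⊗ Z) (X ⊗ M)
    \o cpwm (nk_cpw N) (transp (linfun (@cll k C X M Z))) (idm (X^RR ⊗ Z)).
  apply: cpw_homP => phi.
  rewrite cpw_hom_cpwm compm1 transpE cpw_hom_tensl -compA -compr_tensm.
  rewrite -nki_id -[linfun _]/(cllv X M Z) -cllvC.
  by have [_ _ ->] := projT2 (LdV X M).
by exists (NakayamaTensor PsiK PsiVK PsiE PhiK PhiVK PhiE).
Qed.

End NakayamaTensor.

(** * From traces to points of N(1) *)

Section MonoTensor.
Variables (k : fieldType) (C : lincat k).

Lemma comp_epi (X Y Z : C) (g : Hom Y Z) (f : Hom X Y) :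
  is_epi g -> is_epi f -> is_epi (g \o f).
Proof.
move=> gE fE W u v uv; apply: gE; apply: fE.
by rewrite -!compA.
Qed.

Lemma iso_mono (X Y : C) (f : Hom X Y) : is_iso f -> is_mono f.
Proof.
by move=> [g [gf _]] Z u v uv; rewrite -[u]comp1m -[v]comp1m -gf -!compA uv.
Qed.

Lemma iso_epi (X Y : C) (f : Hom X Y) : is_iso f -> is_epi f.
Proof.
by move=> [g [_ fg]] Z u v uv; rewrite -[u]compm1 -[v]compm1 -fg !compA uv.
Qed.

Lemma comp_mono (X Y Z : C) (g : Hom Y Z) (f : Hom X Y) :
  is_mono g -> is_mono f -> is_mono (g \o f).
Proof.
move=> gM fM W u v uv; apply: fM; apply: gM.
by rewrite !compA.
Qed.

Lemma epi_iso_cancel (W X Y Z : C) (g : Hom Y Z) (f : Hom X Y) (h : Hom W X) :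
  is_iso g -> is_epi (g \o (f \o h)) -> is_epi f.
Proof.
move=> [g' [g'g gg']] E V u v uv.
suff : u \o g' = v \o g'.
  by move=> /(congr1 (fun w => w \o g)); rewrite -!compA g'g !compm1.
apply: E; rewrite !compA -!(compA _ g' g) g'g !compm1.
by rewrite uv.
Qed.

Lemma adj_mono (F H : endofun C) (a : adjunction F H) (X Y : C) (f : Hom X Y) :
  is_mono f -> is_mono (em H f).
Proof.
move=> fM Z u v uv; rewrite -[u](uncK a) -[v](uncK a); congr (cur a _).
by apply: fM; rewrite -!unc_natr uv.
Qed.

End MonoTensor.

Lemma tensm_iso (k : fieldType) (C : smcat k) (X X' Y Y' : C) (f : Hom X X')
    (g : Hom Y Y') : is_iso f -> is_iso g -> is_iso (f ⊗₁ g).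
Proof.
move=> [f' [f'f ff']] [g' [g'g gg']]; exists (f' ⊗₁ g').
by rewrite -!tensm_comp f'f g'g ff' gg' !tensm_id.
Qed.

Section TracePoint.
Variables (k : fieldType) (C : ftcat k) (p : pivotal C).
Variables (G : C) (PG : is_progen G) (N : nakayama C) (S : nakayama_tensor N).
Implicit Types X Y Z M W : C.
Notation D := (ft_rigid C).
Notation Psi := (nkPsi S).
Notation Phi := (nkPhi S).

Lemma piv_iso X : is_iso (piv p X).
Proof. by exists (pivV p X); rewrite pivK pivVK. Qed.

Lemma nkPsi_iso M X : is_iso (Psi M X).
Proof. by exists (nkPsiV S M X); rewrite nkPsiK nkPsiVK. Qed.

Lemma nmor_iso M M' (f : Hom M M') : is_iso f -> is_iso (nmor N f).
Proof.
move=> [g [gf fg]]; exists (nmor N g).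
by rewrite -!nmor_comp gf fg !nmor_id.
Qed.

(* The extension of a : 1 -> N(1) to id -> N through Psi and, up to p_{**X},
   through Phi. *)
Definition extr (a : Hom one (N one)) X : Hom X (N X) :=
  nmor N (lun X) \o Psi one X \o (a ⊗₁ piv p X) \o lunV X.
Definition extl (a : Hom one (N one)) X : Hom X^RR (N X) :=
  nmor N (run X) \o Phi X one \o (idm X^RR ⊗₁ a) \o runV X^RR.

(** The two equations differ by composition with the isomorphism [nmor N (lun X) \o Psi one X] and
    by unit casts. *)
Lemma radford_ext a X :
  radford S X \o (idm X^RR ⊗₁ a) =
    (a ⊗₁ idm X^LL) \o lunV X^LL \o piv p X \o pivrr p X \o run X^RR <->
  extl a X = extr a X \o pivrr p X.
Proof.
have e0 : eqhom (f_equal N (tens_one_comm X)) =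
    nmor N (lunV X) \o nmor N (run X).
  by rewrite -nmor_eqhom -nmor_comp /lunV /run eqhom_comp; congr nmor;
     apply: eqhom_irr.
have e1 : (a ⊗₁ piv p X) \o lunV X = (a ⊗₁ idm X^LL) \o lunV X^LL \o piv p X.
  by rewrite -compA lunV_nat compA tensm_split.
rewrite /radford /extl /extr -[nmor N (lun X) \o _ \o _ \o _]compA e1 e0.
split=> [/(congr1 (fun f => nmor N (lun X) \o Psi one X \o f \o runV X^RR)) | ].
  have Er (f : Hom X^RR (N X)) : f = f \o run X^RR \o runV X^RR.
    by rewrite -compA run_runV compm1.
  rewrite !compA => E; rewrite [RHS]Er -E.
  congr (_ \o _ \o _ \o _).
  rewrite -[nmor N (lun X) \o _ \o _]compA nkPsiVK compm1.
  by rewrite -nmor_comp lun_lunV nmor_id comp1m.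
move=> /(congr1 (fun f => nkPsiV S one X \o nmor N (lunV X) \o f \o run X^RR)).
rewrite !compA -[X in X = _]compA runV_run compm1 => ->.
congr (_ \o _ \o _ \o _ \o _ \o _); rewrite -[LHS]compm1 -[RHS]comp1m.
rewrite -(nkPsiK S one X) compm1.
rewrite -[nkPsiV _ _ _ \o _ \o _]compA -nmor_comp lunV_lun nmor_id compm1.
by rewrite nkPsiK !comp1m.
Qed.

Lemma extr_iso a X : is_iso a -> is_iso (extr a X).
Proof.
move=> ai; apply: is_iso_comp; last exact: eqhom_iso.
apply: is_iso_comp; last exact: tensm_iso ai (piv_iso X).
by apply: is_iso_comp (nkPsi_iso _ _); apply: nmor_iso; apply: eqhom_iso.
Qed.

Lemma extrZ a X c : extr (c *: a) X = c *: extr a X.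
Proof.
rewrite /extr.
have -> : (c *: a) ⊗₁ piv p X = c *: (a ⊗₁ piv p X).
  have := @tensm_linl _ C _ _ _ _ (piv p X) c a (0 : Hom one (N one)).
  have L0 : (0 : Hom one (N one)) ⊗₁ piv p X = 0.
    by rewrite -(linfun_linE (@tensm_linl _ C _ _ _ _ (piv p X))) linear0.
  by rewrite L0 !addr0.
by rewrite compmZ compZm.
Qed.

Lemma ev_neq0 X : ~ is_zero_obj X -> ev D X <> 0.
Proof.
move=> X0 ev0; apply: X0; rewrite /is_zero_obj -(ev_coev D X) ev0.
rewrite -(linfun_linE (@tensm_linr _ C _ _ _ _ (idm X))) linear0.
by rewrite compm0 !comp0m.
Qed.

Lemma ev_epi X : ~ is_zero_obj X -> is_epi (ev D X).
Proof. by move=> /ev_neq0; apply: (simple_epi PG (ft_unit C)). Qed.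

Lemma progen_nonzero : ~ is_zero_obj G.
Proof. exact: (pg_neq0 PG (proj1 (ft_unit C))). Qed.

Lemma ld_nonzero X : ~ is_zero_obj X -> ~ is_zero_obj X^L.
Proof.
move=> /ev_neq0 e0 X0; apply: e0.
rewrite -[ev D X]compm1 -tensm_id X0.
rewrite -(linfun_linE (@tensm_linl _ C _ _ _ _ (idm X))) linear0.
by rewrite compm0.
Qed.

(** The evaluation of Y is epi because the unit is simple, so u can be recovered from u ⊗ id on
    [Y^L ⊗ Y]. *)
Lemma tensr_faithful Y (X X' : C) (u v : Hom X X') :
  ~ is_zero_obj Y -> u ⊗₁ idm Y^L = v ⊗₁ idm Y^L -> u = v.
Proof.
move=> Y0 uv; have eE := epi_tensl (X := X) D (ev_epi Y0).
apply: (iso_epi (eqhom_iso (tenso1 X))); rewrite -![eqhom _]/(run _).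
rewrite -(run_nat u) -(run_nat v); congr (_ \o _).
apply: eE; rewrite !tensm_split -(tensm_split' u) -(tensm_split' v).
congr (_ \o _).
have E (w : Hom X X') : w ⊗₁ idm (Y^L ⊗ Y) =
    asc X' Y^L Y \o ((w ⊗₁ idm Y^L) ⊗₁ idm Y) \o ascV X Y^L Y.
  by rewrite asc_nat tensm_id -compA asc_ascV compm1.
by rewrite !E uv.
Qed.

(** Up to isomorphisms this is a ⊗ id on [X^LL], and tensoring with [X^LL] is a right adjoint, hence
    preserves monomorphisms. *)
Lemma extr_mono a X : is_mono a -> is_mono (extr a X).
Proof.
move=> aM.
have E : a ⊗₁ piv p X = (a ⊗₁ idm X^LL) \o (idm one ⊗₁ piv p X).
  by rewrite tensm_split.
rewrite /extr E !compA.
apply: comp_mono; last by apply: iso_mono; apply: eqhom_iso.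
apply: comp_mono.
  apply: comp_mono; last exact: (adj_mono (adjr D X^L)).
  apply: iso_mono; apply: is_iso_comp (nkPsi_iso _ _).
  by apply: nmor_iso; apply: eqhom_iso.
by apply: iso_mono; apply: tensm_iso (piv_iso X); apply: (eqhom_iso erefl).
Qed.

Lemma extr_iso_point (a : Hom one (N one)) : a <> 0 -> is_iso a.
Proof.
move=> a0; have aM := simple_mono PG (ft_unit C) a0.
apply: (pg_bij_iso PG) => //.
have eM := extr_mono (X := G) aM.
(* Hom(G, N(G)) is in bijection with the dual of Hom(G, G), so the injective map induced by
   [extr a G] is surjective by dimension. *)
have eE : is_epi (extr a G).
  apply: (pg_surj_epi PG) => y; pose f := postcomp G (extr a G).
  have [||x <-] := @lfun_inj_surj _ _ _ f _ _ y; last first.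
  - by exists x; rewrite /f postcompE.
  - rewrite -(lfun_bij_dim (nki_progen_bij PG N G)).
    by rewrite dualv_dim.
  - by move=> x x'; rewrite /f !postcompE => /eM.
(* Stripping the invertible factor of [extr a G] leaves a ⊗ id; faithfulness of tensoring with
   [G^LL] then gives that a is epi. *)
have aE : is_epi (a ⊗₁ idm G^LL).
  have i1 : is_iso (nmor N (lun G) \o Psi one G).
    by apply: is_iso_comp (nkPsi_iso _ _); apply: nmor_iso; apply: eqhom_iso.
  have eaE : extr a G = (nmor N (lun G) \o Psi one G) \o
      ((a ⊗₁ idm G^LL) \o ((idm one ⊗₁ piv p G) \o lunV G)).
    by rewrite /extr -(tensm_split a) !compA.
  by move: eE; rewrite eaE; apply: epi_iso_cancel.
move=> W u v uv; apply: (tensr_faithful (Y := G^L)).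
  by apply: ld_nonzero; apply: progen_nonzero.
by apply: aE; rewrite -!compl_tensm uv.
Qed.

End TracePoint.

Lemma nmor0 (k : fieldType) (C : lincat k) (N : nakayama C) (M M' : C) :
  nmor N (0 : Hom M M') = 0.
Proof.
apply: nki_inj => Z phi; rewrite nmorE comp0m -[RHS](linear0 (nki N Z M')).
congr (nki N _ _ _); apply/lfunP => g.
by rewrite comp_lfunE precompE compm0 linear0 zero_lfunE.
Qed.

Section TraceToPoint.
Variables (k : fieldType) (C : ftcat k) (p : pivotal C).
Variables (G : C) (PG : is_progen G) (N : nakayama C) (S : nakayama_tensor N).
Implicit Types X Y Z M W : C.
Notation D := (ft_rigid C).
Notation Psi := (nkPsi S).
Notation Phi := (nkPhi S).
Variables (t : trfam C) (tM : modified_trace p t).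

Definition trmor (P : projobj C) : Hom P (N P) := nki N P P (t P).

Lemma trmorE (P : projobj C) Z (f : Hom Z P) :
  trmor P \o f = nki N Z P (t P \o postcomp P f)%VF.
Proof. exact: nki_nat. Qed.

Lemma trmor_nat (P Q : projobj C) (f : Hom P Q) :
  nmor N f \o trmor P = trmor Q \o f.
Proof.
rewrite trmorE nmorE; congr (nki N _ _ _); apply/lfunP => g.
by rewrite !comp_lfunE precompE postcompE (mt_cyclic tM).
Qed.

(** The right partial trace condition is an equality of functionals; the universal map carries it to
    this equality of morphisms. *)
Lemma trmor_tensr (P : projobj C) X :
  Psi P X \o (trmor P ⊗₁ piv p X) = trmor (ptensr P X).
Proof.
rewrite -(tensm_split (trmor P)) compA nkPsi_nki.
have -> : (t P \o clrv P P X)%VF =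
    (t (ptensr P X) \o postcomp (P ⊗ X) (idm P ⊗₁ pivV p X))%VF.
  by apply/lfunP => f; rewrite !comp_lfunE clrvE postcompE (mt_right tM).
rewrite -nki_nat -compA -compr_tensm pivK tensm_id.
exact: compm1.
Qed.

Lemma trmor_tensl (P : projobj C) X :
  Phi X P \o (idm _ ⊗₁ trmor P) = trmor (ptensl X P) \o (pivrr p X ⊗₁ idm P).
Proof.
rewrite nkPhi_nki trmorE; congr (nki N _ _ _).
by apply/lfunP => f; rewrite !comp_lfunE cllvE postcompE (mt_left tM).
Qed.

(** [e0] is the epimorphism from a projective object onto the unit that is used to define the point
    a. *)
Let PGo : projobj C := ProjObj (pg_projective PG).
Let P0 : projobj C := ptensl G^L PGo.
Let e0 : Hom P0 one := ev D G.

Lemma e0_epi : is_epi e0.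
Proof. exact: (ev_epi PG (progen_nonzero PG)). Qed.

Lemma trace_point : exists a : Hom one (N one),
  (forall P, trmor P = extr p S a P) /\
  (forall X, extl S a X = extr p S a X \o pivrr p X).
Proof.
(* If x : G -> P0 is killed by e0, naturality of [trmor] moves x inside and leaves N(e0 x) = 0, so
   the map factors through e0. *)
have [|a aE] := pg_factor PG (f := nmor N e0 \o trmor P0) e0_epi.
  move=> x ex; rewrite -compA -(@trmor_nat PGo P0) compA -nmor_comp ex.
  by rewrite nmor0 comp0m.
exists a.
have qr X : is_epi (lun X \o (e0 ⊗₁ idm X)).
  by apply: comp_epi (epi_tensr D e0_epi); apply: iso_epi; apply: eqhom_iso.
have ql X : is_epi (run X \o (idm X ⊗₁ e0)).
  by apply: comp_epi (epi_tensl D e0_epi); apply: iso_epi; apply: eqhom_iso.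
have extr0 X : extr p S a X \o (lun X \o (e0 ⊗₁ idm X)) =
    nmor N (lun X \o (e0 ⊗₁ idm X)) \o trmor (ptensr P0 X).
  rewrite /extr compA -(compA _ (lunV X)) lunV_lun compm1 -compA -tensm_comp.
  rewrite -aE compm1 -(comp1m (piv p X)) tensm_comp !compA.
  rewrite -(compA _ (Psi _ _)) -nkPsi_natl -trmor_tensr nmor_comp !compA.
  by [].
(* X is a quotient of the projective P0 ⊗ X, where the claim is known; f lifts to it since Q is
   projective, and [trmor] is natural between projectives. *)
have extrE X (Q : projobj C) (f : Hom Q X) :
    extr p S a X \o f = nmor N f \o trmor Q.
  have [g gE] := @pobj_proj _ _ Q _ _ _ f (qr X).
  rewrite -gE [LHS]compA extr0 -[LHS]compA (nmor_comp _ _ g) -[RHS]compA.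
  congr (_ \o _).
  exact: esym (@trmor_nat Q (ptensr P0 X) g).
split=> [P | X]; first by rewrite -[RHS]compm1 extrE nmor_id comp1m.
(* Equality is tested on X^RR ⊗ P0, where the left trace condition describes Phi. *)
apply: (ql X^RR).
rewrite /extl compA -(compA _ (runV _)) runV_run compm1 -compA -tensm_comp.
rewrite -aE comp1m -[I in I ⊗₁ _]comp1m tensm_comp [LHS]compA.
rewrite -(compA _ (Phi _ _)) -nkPhi_natr (compA (nmor N (run X))) -nmor_comp.
rewrite -(compA _ (Phi _ _)) trmor_tensl [LHS]compA -extrE.
rewrite -[LHS]compA -[RHS]compA; congr (_ \o _).
rewrite [RHS]compA -run_nat -[LHS]compA -[RHS]compA; congr (_ \o _).
by rewrite tensm_split tensm_split'.
Qed.

End TraceToPoint.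

(** * Uniqueness, non-degeneracy and sphericality *)

Section TraceProperties.
Variables (k : closedFieldType) (C : ftcat k) (p : pivotal C).
Variables (G : C) (PG : is_progen G) (N : nakayama C) (S : nakayama_tensor N).

Lemma trmor_inj (t t' : trfam C) (P : projobj C) :
  trmor N t P = trmor N t' P -> t P = t' P.
Proof. exact: (nki_proj_inj PG (@pobj_proj _ _ P)). Qed.

Lemma point_iso (t : trfam C) a : tr_nonzero t ->
  (forall P, trmor N t P = extr p S a P) -> is_iso a.
Proof.
move=> [P tP] aE; apply: (extr_iso_point p PG S) => a0; apply: tP.
apply: (@trmor_inj t (fun _ => 0)).
rewrite /trmor linear0 -/(trmor N t P) aE a0 -[0 in LHS](scale0r 0) extrZ.
by rewrite scale0r.
Qed.

(** The points a and a' determine the traces, a is invertible with inverse b, and b a' is a scalar c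
    by Schur's lemma; hence a' = c a. *)
Lemma trace_unique (t t' : trfam C) :
  modified_trace p t -> tr_nonzero t ->
  modified_trace p t' -> tr_nonzero t' ->
  exists c : k, forall P : projobj C, t' P = c *: t P.
Proof.
move=> tM t0 tM' _.
have [a [aE _]] := trace_point PG S tM.
have [a' [aE' _]] := trace_point PG S tM'.
have [b [_ ab]] := point_iso t0 aE.
have [c cE] := simple_End PG (b \o a') (ft_unit C).
exists c => P; apply: (@trmor_inj t' (fun P => c *: t P)).
have -> : trmor N (fun P => c *: t P) P = c *: trmor N t P.
  by rewrite /trmor linearZ.
rewrite aE' aE -extrZ; congr (extr p S _ P).
by rewrite -[LHS]comp1m -ab -compA cE compmZ compm1.
Qed.

Lemma trace_nondegenerate (t : trfam C) :
  modified_trace p t -> tr_nonzero t -> tr_nondegenerate t.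
Proof.
move=> tM t0 M P; have [a [aE _]] := trace_point PG S tM.
have PP := @pobj_proj _ _ P.
have [i [ip pi]] : is_iso (trmor N t P).
  by rewrite aE; apply: extr_iso; apply: point_iso t0 aE.
split=> [f fE | g gE].
  (* Composing f with the invertible [trmor N t P] gives the universal map at the functional t_P(f
     -), which is zero. *)
  rewrite -[f]comp1m -ip -compA trmorE.
  have -> : (t P \o postcomp P f)%VF = 0.
    by apply/lfunP => g; rewrite comp_lfunE postcompE fE zero_lfunE.
  by rewrite linear0 compm0.
apply: dualv_sep => phi.
(* Invertibility makes every functional on Hom(P, M) of the form t_P(f -), so g is killed by all
   functionals. *)
suff -> : phi = (t P \o postcomp P (i \o nki N M P phi)%cat)%VF.
  by rewrite comp_lfunE postcompE gE.
apply: (nki_proj_inj (N := N) PG PP); rewrite -nki_nat compA.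
by rewrite [I in I \o _]pi comp1m.
Qed.

Lemma trace_spherical (t : trfam C) :
  modified_trace p t -> tr_nonzero t -> spherical p.
Proof.
move=> tM t0; have [a [aE aR]] := trace_point PG S tM.
have aI := point_iso t0 aE.
exists N, S; split; last first.
  by exists a; split=> // X; apply/radford_ext; apply: aR.
by have [b [ba ab]] := aI; exists b, a.
Qed.

End TraceProperties.

(** * From points of N(1) to traces *)

Section ClosingIdentities.
Variables (k : fieldType) (C : ftcat k).
Implicit Types X Y Z M N W : C.
Notation D := (ft_rigid C).
Notation ev := (ev D).
Notation coev := (coev D).
Notation ev' := (ev' D).
Notation coev' := (coev' D).

Lemma pdom_comp (p q : parr C) : pcod q = pdom p -> pdom (p ∙ q) = pdom q.
Proof.
case: p q => [[X Y f]|] [[X' Y' g]|] //= [e].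
by case: pselect.
Qed.

Lemma pwhiskl3 W (p q r : parr C) : pcod q = pdom p -> pcod r = pdom q ->
  𝟙W ⊠ (p ∙ q ∙ r) = (𝟙W ⊠ p) ∙ (𝟙W ⊠ q) ∙ (𝟙W ⊠ r).
Proof. by move=> e e'; rewrite !pwhiskl ?pdom_comp. Qed.

Lemma pwhiskr3 W (p q r : parr C) : pcod q = pdom p -> pcod r = pdom q ->
  (p ∙ q ∙ r) ⊠ 𝟙W = (p ⊠ 𝟙W) ∙ (q ⊠ 𝟙W) ∙ (r ⊠ 𝟙W).
Proof. by move=> e e'; rewrite !pwhiskr ?pdom_comp. Qed.

Lemma ar_clr M N X (f : Hom (M ⊗ X) (N ⊗ X^LL)) :
  ar (clr f) = (𝟙N ⊠ ar (ev X^L)) ∙ (ar f ⊠ 𝟙X^L) ∙ (𝟙M ⊠ ar (coev X)).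
Proof.
rewrite /clr /run /asc /ascV /runV ar_eqhomr ar_comp ar_eqhomr ar_comp.
by rewrite ar_eqhomr ar_eqhoml.
Qed.

Lemma ar_cll X M N (f : Hom (X ⊗ M) (X^RR ⊗ N)) :
  ar (cll f) = (ar (ev' X^R) ⊠ 𝟙N) ∙ (𝟙X^R ⊠ ar f) ∙ (ar (coev' X) ⊠ 𝟙M).
Proof.
rewrite /cll /lun /asc /ascV /lunV ar_eqhomr ar_comp ar_eqhomr ar_comp.
by rewrite ar_eqhomr ar_eqhoml.
Qed.

Lemma ar_ldm X Y (f : Hom X Y) : ar (ldm D f) =
  (ar (ev Y \o (idm Y^L ⊗₁ f)) ⊠ 𝟙X^L) ∙ (𝟙Y^L ⊠ ar (coev X)).
Proof.
rewrite /ldm /lun /ascV /runV ar_eqhomr ar_comp ar_eqhomr.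
by rewrite ar_eqhoml.
Qed.

Lemma ldm_ev X Y (f : Hom X Y) :
  ev X \o (ldm D f ⊗₁ idm X) = ev Y \o (idm Y^L ⊗₁ f).
Proof.
apply: ar_inj; set g := ev Y \o _; rewrite ar_comp ar_tens ar_ldm -/g.
rewrite pwhiskr; last by rewrite /= tensA.
rewrite pcompA -[ar (ev X)]p1tens ptensA ar_id -pslide ptens1 -ar_id.
rewrite -pcompA !ptensA -pwhiskl; last by rewrite /= tensA.
by rewrite zigzag_ev ar_id pcomp1.
Qed.

Lemma ldm_coev X Y (f : Hom X Y) :
  (idm Y ⊗₁ ldm D f) \o coev Y = (f ⊗₁ idm X^L) \o coev X.
Proof.
apply: ar_inj; rewrite !ar_comp !ar_tens ar_ldm.
rewrite pwhiskl; last by rewrite /= tensA.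
have e1 : (𝟙Y ⊠ (𝟙Y^L ⊠ ar (coev X))) ∙ ar (coev Y) =
    (ar (coev Y) ⊠ 𝟙X ⊠ 𝟙X^L) ∙ ar (coev X).
  have := pslide (coev Y) (coev X).
  by rewrite -!ar_id p1tens ptens1 !ptensA => ->.
have e2 : (𝟙Y ⊠ ar (ev Y \o (idm Y^L ⊗₁ f))) ∙ (ar (coev Y) ⊠ 𝟙X) = ar f.
  rewrite ar_comp ar_tens pwhiskl // -ptensA ar_id -pcompA -pslide pcompA.
  by rewrite zigzag_ev p1tens p1comp.
rewrite -pcompA e1 pcompA -ptensA -pwhiskr ?e2 //.
by rewrite /= tensA.
Qed.

(** h passes through the coevaluation as its dual, slides along the closed strand, and passes
    through the evaluation as its double dual. *)
Lemma clr_dinat M Z X Y (h : Hom X Y) (f : Hom (M ⊗ Y) (Z ⊗ X^LL)) :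
  clr (f \o (idm M ⊗₁ h)) = clr ((idm Z ⊗₁ ddm h) \o f).
Proof.
apply: ar_inj; rewrite !ar_clr !ar_comp !ar_tens !pwhiskr //.
have e1 : (𝟙M ⊠ ar h ⊠ 𝟙X^L) ∙ (𝟙M ⊠ ar (coev X)) =
    (𝟙(M ⊗ Y) ⊠ ar (ldm D h)) ∙ (𝟙M ⊠ ar (coev Y)).
  rewrite ptensA -pwhiskl // -ar_tens -ar_comp -ldm_coev ar_comp ar_tens.
  by rewrite pwhiskl // -ptensA ar_id.
have e2 : (𝟙Z ⊠ ar (ev X^L)) ∙ (𝟙(Z ⊗ X^LL) ⊠ ar (ldm D h)) =
    (𝟙Z ⊠ ar (ev Y^L)) ∙ (𝟙Z ⊠ ar (ddm h) ⊠ 𝟙Y^L).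
  rewrite -ar_id ptensA -pwhiskl // -ar_tens -ar_comp -ldm_ev ar_comp ar_tens.
  by rewrite pwhiskl // -ptensA.
by rewrite -!pcompA e1 !pcompA -e2 -!pcompA (pcompA (ar f ⊠ _)) pslide !pcompA.
Qed.

(** The two closings involve disjoint strands, so the evaluations and coevaluations slide past each
    other. *)
Lemma cll_clr X M Y Z (f : Hom (X ⊗ (M ⊗ Y)) ((X^RR ⊗ Z) ⊗ Y^LL)) :
  cll (clr (f \o asc X M Y)) = clr (cll (asc X^RR Z Y^LL \o f)).
Proof.
apply: ar_inj; rewrite ar_cll !ar_clr ar_cll ar_eqhoml ar_eqhomr.
rewrite pwhiskl3 ?pwhiskr3; try by rewrite /= ?tensA.
have e1 : (ar (ev' X^R) ⊠ 𝟙Z) ∙ (𝟙X^R ⊠ (𝟙(X^RR ⊗ Z) ⊠ ar (ev Y^L))) =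
   (𝟙Z ⊠ ar (ev Y^L)) ∙ (ar (ev' X^R) ⊠ 𝟙(Z ⊗ Y^LL) ⊠ 𝟙Y^L).
  have := pslide (ev' X^R ⊗₁ idm Z) (ev Y^L).
  by rewrite ar_tens -!ar_id !ptensA ?p1tens ?ptens1.
have e2 : (𝟙X^R ⊠ (𝟙(X ⊗ M) ⊠ ar (coev Y))) ∙ (ar (coev' X) ⊠ 𝟙M) =
   (ar (coev' X) ⊠ 𝟙(M ⊗ Y) ⊠ 𝟙Y^L) ∙ (𝟙M ⊠ ar (coev Y)).
  have := pslide (coev' X ⊗₁ idm M) (coev Y).
  by rewrite ar_tens -!ar_id !ptensA ?p1tens ?ptens1 => ->.
by rewrite !pcompA e1 -!pcompA e2 !ptensA.
Qed.

Lemma ar_ev_tens X Y : ar (ev (X ⊗ Y)) =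
  ar (ev Y) ∙ (𝟙Y^L ⊠ (ar (ev X) ⊠ 𝟙Y)).
Proof.
have := congr1 (@ar k C _ _) (ev_tens (ft_strict C) X Y).
rewrite -[idm (X ⊗ Y)]/(eqhom erefl) eqhom_tens ar_eqhomr => ->.
by rewrite /asc /lun /ascV ar_eqhomr ar_comp ar_tens ar_eqhomr ar_eqhoml.
Qed.

(** Strictness of duality prescribes only the evaluation. The nested coevaluation [c] satisfies a
    zigzag identity with it, and this determines the coevaluation. *)
Lemma ar_coev_tens X Y : ar (coev (X ⊗ Y)) =
  (𝟙X ⊠ (ar (coev Y) ⊠ 𝟙X^L)) ∙ ar (coev X).
Proof.
have LE : (X ⊗ Y)^L = Y^L ⊗ X^L by rewrite -(ld_tens (ft_strict C)).
have e0 : X ⊗ ((Y ⊗ Y^L) ⊗ X^L) = (X ⊗ Y) ⊗ (X ⊗ Y)^L.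
  by rewrite LE !tensA.
pose c := eqhom e0 \o (idm X ⊗₁ ((coev Y ⊗₁ idm X^L) \o lunV X^L)) \o coev X.
have cE : ar c = (𝟙X ⊠ (ar (coev Y) ⊠ 𝟙X^L)) ∙ ar (coev X).
  by rewrite /c ar_comp ar_eqhoml ar_tens /lunV ar_eqhomr ar_tens.
rewrite -cE.
have zz : (ar (ev (X ⊗ Y)) ⊠ 𝟙(X ⊗ Y)^L) ∙ (𝟙(X ⊗ Y)^L ⊠ ar c) =
    𝟙(X ⊗ Y)^L.
  have slide : (𝟙Y^L ⊠ (ar (ev X) ⊠ (𝟙Y ⊠ (𝟙Y^L ⊠ 𝟙X^L))))
      ∙ (𝟙Y^L ⊠ (𝟙X^L ⊠ (𝟙X ⊠ (ar (coev Y) ⊠ 𝟙X^L)))) =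
      (𝟙Y^L ⊠ (ar (coev Y) ⊠ 𝟙X^L)) ∙ (𝟙Y^L ⊠ (ar (ev X) ⊠ 𝟙X^L)).
    have := congr1 (ptens 𝟙Y^L) (pslide (ev X) (coev Y ⊗₁ idm X^L)).
    rewrite !pwhiskl //.
    by rewrite -!ar_id !p1tens ar_tens !ptensA.
  rewrite ar_ev_tens cE LE.
  rewrite pwhiskl; last by rewrite /= ?tens1o.
  rewrite pwhiskr; last by rewrite /= ?tens1o.
  rewrite -!ar_id !ptensA !pcompA -(pcompA (ar (ev Y) ⊠ _)) slide pcompA.
  have zY : (ar (ev Y) ⊠ (𝟙Y^L ⊠ 𝟙X^L)) ∙ (𝟙Y^L ⊠ (ar (coev Y) ⊠ 𝟙X^L)) =
      𝟙Y^L ⊠ 𝟙X^L.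
    rewrite -!ptensA -pwhiskr ?zigzag_coev //.
    by rewrite /= ?tensA.
  rewrite zY -pcompA -pwhiskl; last by rewrite /= ?tensA.
  by rewrite zigzag_coev ar_id pcomp1.
(* The other zigzag, for the given coevaluation, is inserted after [c]; after a slide, [zz] removes
   [c] and leaves that coevaluation. *)
have c1 : ar c = ((𝟙(X ⊗ Y) ⊠ ar (ev (X ⊗ Y)))
    ∙ (ar (coev (X ⊗ Y)) ⊠ 𝟙(X ⊗ Y))) ⊠ 𝟙(X ⊗ Y)^L ∙ ar c.
  by rewrite zigzag_ev ar_id p1comp.
rewrite c1 pwhiskr; last by rewrite /= tensA.
have := pslide (coev (X ⊗ Y)) c; rewrite p1tens ptens1 -ar_id -ptensA => e1.
rewrite -pcompA e1 pcompA !ptensA -pwhiskl.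
  by rewrite zz ar_id p1comp.
by rewrite /= !tensA.
Qed.

(** Closing Y and then X is closing X ⊗ Y at once, since its evaluation and coevaluation are
    nested. *)
Lemma clr_tens M Z X Y (f : Hom (M ⊗ (X ⊗ Y)) ((Z ⊗ X^LL) ⊗ Y^LL)) :
  clr (clr (f \o asc M X Y)) =
  clr ((idm Z ⊗₁ eqhom (dd_tens X Y)) \o asc Z X^LL Y^LL \o f).
Proof.
apply: ar_inj; rewrite !ar_clr ar_eqhomr.
rewrite pwhiskr3; try by rewrite /= ?tensA.
rewrite -compA -[idm Z]/(eqhom erefl) eqhom_tens ar_eqhoml ar_eqhoml.
rewrite ar_coev_tens -(ld_tens (ft_strict C)) ar_ev_tens.
rewrite !pwhiskl; try by rewrite /= ?tens1o.
have -> : ar (eqhom (erefl Z)) = 𝟙Z by [].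
by rewrite -!ar_id !ptensA !pcompA.
Qed.

End ClosingIdentities.

(** * Module compatibilities of Psi and Phi and the trace of a point *)

Section PointToTrace.
Variables (k : fieldType) (C : ftcat k) (p : pivotal C).
Variables (G : C) (PG : is_progen G) (N : nakayama C) (S : nakayama_tensor N).
Implicit Types X Y Z M W : C.
Notation D := (ft_rigid C).
Notation Psi := (nkPsi S).
Notation Phi := (nkPhi S).

Lemma nkPsi_natr M X Y (h : Hom X Y) :
  nmor N (idm M ⊗₁ h) \o Psi M X = Psi M Y \o (idm (N M) ⊗₁ ddm h).
Proof.
apply: nki_tensr_inj => Z phi.
rewrite -compA nkPsi_nki nmorE -compA tensm_split'.
rewrite -(tensm_split (nki N Z M phi)) compA.
rewrite nkPsi_nki nki_nat; congr (nki N _ _ _); apply/lfunP => f.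
by rewrite !comp_lfunE precompE postcompE !clrvE clr_dinat.
Qed.

Lemma nkPsi_assoc M X Y :
  nmor N (asc M X Y) \o Psi (M ⊗ X) Y \o (Psi M X ⊗₁ idm Y^LL) =
  Psi M (X ⊗ Y) \o (idm (N M) ⊗₁ eqhom (dd_tens X Y)) \o asc (N M) X^LL Y^LL.
Proof.
(* Transposing the factor [Y^LL] leaves a single tensor factor, so both sides can be compared on the
   universal maps of the coend. *)
apply: (@cur_inj _ _ _ _ (adjr D Y^LL)); apply: nki_tensr_inj => Z phi.
rewrite -!cur_natl; congr (cur _ _) => /=.
rewrite -!compA -compl_tensm nkPsi_nki nkPsi_nki nmorE.
rewrite asc_nat tensm_id (compA (_ ⊗₁ eqhom _)) tensm_split'.
rewrite -(tensm_split _ (eqhom _)).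
rewrite !compA nkPsi_nki -compA nki_nat; congr (nki N _ _ _).
apply/lfunP => f; rewrite !comp_lfunE precompE postcompE !clrvE clr_tens.
by [].
Qed.

Lemma nkPhi_nkPsi X M Y :
  nmor N (asc X M Y) \o Psi (X ⊗ M) Y \o (Phi X M ⊗₁ idm Y^LL) =
  Phi X (M ⊗ Y) \o (idm X^RR ⊗₁ Psi M Y) \o asc X^RR (N M) Y^LL.
Proof.
apply: (@cur_inj _ _ _ _ (adjr D Y^LL)); apply: nki_tensl_inj => Z phi.
rewrite -!cur_natl; congr (cur _ _) => /=.
rewrite -!compA -compl_tensm nkPhi_nki nkPsi_nki nmorE.
rewrite asc_nat (compA (idm X^RR ⊗₁ _)) -compr_tensm nkPsi_nki.
rewrite compA nkPhi_nki nki_nat; congr (nki N _ _ _).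
apply/lfunP => f; rewrite !comp_lfunE precompE postcompE !clrvE !cllvE.
by rewrite cll_clr.
Qed.

Variable a : Hom one (N one).
Notation eta := (extr p S a).

Lemma extr_nat X Y (f : Hom X Y) : nmor N f \o eta X = eta Y \o f.
Proof.
rewrite /extr -[RHS]compA lunV_nat !compA -nmor_comp -lun_nat nmor_comp.
rewrite -(compA (nmor N (lun Y))) nkPsi_natr -!compA; congr (_ \o (_ \o _)).
rewrite !compA; congr (_ \o _).
by rewrite -!tensm_comp !comp1m compm1 piv_nat.
Qed.

(** Monoidality of the pivotal structure splits p at X ⊗ Y, and associativity of Psi splits the map
    through which a is extended. *)
Lemma extr_tensr X Y : eta (X ⊗ Y) = Psi X Y \o (eta X ⊗₁ piv p Y).
Proof.
have e1 : eta X ⊗₁ piv p Y = (nmor N (lun X) ⊗₁ idm Y^LL)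
    \o (Psi one X ⊗₁ idm Y^LL) \o (((a ⊗₁ piv p X) \o lunV X) ⊗₁ piv p Y).
  by rewrite /extr -!tensm_comp !comp1m !compA.
have e2 : ascV (N one) X^LL Y^LL \o (idm (N one) ⊗₁ eqhom (esym (dd_tens X Y)))
    \o (a ⊗₁ piv p (X ⊗ Y)) \o lunV (X ⊗ Y) =
    ((a ⊗₁ piv p X) \o lunV X) ⊗₁ piv p Y.
  apply: ar_inj; rewrite /lunV ar_eqhomr -compA ar_eqhoml.
  rewrite -[idm (N one)]/(eqhom erefl) eqhom_tens ar_eqhoml !ar_tens ar_eqhomr.
  by rewrite ar_tens piv_tens ar_eqhoml ar_tens ptensA.
rewrite e1 -e2 !compA -nkPsi_natl.
have -> : lun X ⊗₁ idm Y = lun (X ⊗ Y) \o asc one X Y.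
  rewrite /lun /asc -[idm Y]/(eqhom erefl) eqhom_tens eqhom_comp.
  exact: eqhom_irr.
rewrite nmor_comp -!(compA (nmor N (lun _))) nkPsi_assoc.
rewrite !compA -(compA _ (asc _ _ _)) asc_ascV compm1.
rewrite -(compA _ _ (idm _ ⊗₁ eqhom (esym _))) -compr_tensm eqhom_comp.
by rewrite eqhom_id tensm_id compm1.
Qed.

Hypothesis aR : forall X, extl S a X = eta X \o pivrr p X.

(** After [extr_tensr], the hypothesis rewrites the extension at X through Phi; Phi then commutes
    past Psi, which rebuilds the extension at Y. *)
Lemma extr_tensl X Y :
  eta (X ⊗ Y) \o (pivrr p X ⊗₁ idm Y) = Phi X Y \o (idm _ ⊗₁ eta Y).
Proof.
rewrite extr_tensr -compA -tensm_comp -aR compm1.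
have e1 : extl S a X ⊗₁ piv p Y = (nmor N (run X) ⊗₁ idm Y^LL)
    \o (Phi X one ⊗₁ idm Y^LL)
    \o (((idm X^RR ⊗₁ a) \o runV X^RR) ⊗₁ piv p Y).
  by rewrite /extl -!tensm_comp !comp1m !compA.
have e2 : asc X^RR (N one) Y^LL
    \o (((idm X^RR ⊗₁ a) \o runV X^RR) ⊗₁ piv p Y) =
    (idm X^RR ⊗₁ ((a ⊗₁ piv p Y) \o lunV Y)).
  apply: ar_inj; rewrite ar_eqhoml !ar_tens /runV /lunV !ar_eqhomr !ar_tens.
  exact: ptensA.
rewrite e1 !compA -nkPsi_natl.
have -> : run X ⊗₁ idm Y = (idm X ⊗₁ lun Y) \o asc X one Y.
  rewrite /lun /run /asc -[idm Y]/(eqhom erefl) -[idm X]/(eqhom erefl).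
  rewrite !eqhom_tens eqhom_comp; exact: eqhom_irr.
rewrite nmor_comp -!(compA (nmor N (idm X ⊗₁ _))) nkPhi_nkPsi.
rewrite !compA nkPhi_natr -(compA _ (asc _ _ _)) e2 -!compA -!compr_tensm.
by rewrite /extr !compA.
Qed.

(** t_P is the functional whose universal map is [extr p S a P]. Each trace axiom is an equality of
    functionals, tested after the universal map, which is injective on projectives. *)
Lemma point_trace : exists t : trfam C,
  modified_trace p t /\ forall P, trmor N t P = eta P.
Proof.
pose tP (P : projobj C) :=
  cid (nki_proj_surj PG (eta P) (@pobj_proj _ _ P)).
pose t (P : projobj C) : 'Hom(Hom P P, k^o) := projT1 (tP P).
have tE P : trmor N t P = eta P := projT2 (tP P).
exists t; split=> //; split.
- move=> P Q f g.
  suff /lfunP/(_ g) : (t P \o precomp P f)%VF = (t Q \o postcomp Q f)%VF.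
    by rewrite !comp_lfunE precompE postcompE.
  apply: (nki_proj_inj (N := N) PG (@pobj_proj _ _ Q)).
  rewrite -nmorE -nki_nat -[nki N P P _]/(trmor N t P).
  by rewrite -[nki N Q Q _]/(trmor N t Q) !tE extr_nat.
- move=> P X f.
  suff /lfunP/(_ f) : (t P \o clrv P P X)%VF =
      (t (ptensr P X) \o postcomp (P ⊗ X) (idm P ⊗₁ pivV p X))%VF.
    by rewrite !comp_lfunE clrvE postcompE.
  apply: (nki_proj_inj (N := N) PG (@pobj_proj _ _ (ptensr P X))).
  rewrite -nki_nat -(nkPsi_nki S) -[nki N P P _]/(trmor N t P).
  rewrite -[nki N _ _ (t (ptensr P X))]/(trmor N t (ptensr P X)) !tE.
  by rewrite extr_tensr -compA -tensm_comp pivVK compm1.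
- move=> P X f.
  suff /lfunP/(_ f) : (t P \o cllv X P P)%VF =
      (t (ptensl X P) \o postcomp (X ⊗ P) (pivrr p X ⊗₁ idm P))%VF.
    by rewrite !comp_lfunE cllvE postcompE.
  apply: (nki_proj_inj (N := N) PG (@pobj_proj _ _ (ptensl X P))).
  rewrite -nki_nat -(nkPhi_nki S) -[nki N P P _]/(trmor N t P).
  rewrite -[nki N _ _ (t (ptensl X P))]/(trmor N t (ptensl X P)) !tE.
  by rewrite extr_tensl.
Qed.

End PointToTrace.

Lemma spherical_trace (k : fieldType) (C : ftcat k) (p : pivotal C) :
  spherical p -> exists t : trfam C, modified_trace p t /\ tr_nonzero t.
Proof.
move=> [N [S [_ [a [aI aR]]]]].
have [G PG] := finite_abelian_progen (ft_finite C).
have [|t [tM tE]] := point_trace PG (S := S) (p := p) (a := a).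
  by move=> X; apply/radford_ext.
exists t; split=> //; exists (ProjObj (pg_projective PG)) => t0.
(* If t vanished at G, the invertible extension of a at G would be zero, forcing G = 0. *)
have [g [gE _]] := extr_iso p S G aI.
apply: (progen_nonzero PG); rewrite /is_zero_obj -gE.
have := tE (ProjObj (pg_projective PG)); rewrite /trmor t0 linear0 /= => <-.
by rewrite compm0.
Qed.

Theorem corollary6p11 (k : closedFieldType) (C : ftcat k) (p : pivotal C) :
  ((exists t : trfam C, modified_trace p t /\ tr_nonzero t) <-> spherical p) /\
  (spherical p ->
     (forall t t' : trfam C,
        modified_trace p t -> tr_nonzero t ->
        modified_trace p t' -> tr_nonzero t' ->
        exists c : k, forall P : projobj C, t' P = (c *: t P)%R) /\
     (forall t : trfam C,
        modified_trace p t -> tr_nonzero t -> tr_nondegenerate t)).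
Proof.
have [G PG] := finite_abelian_progen (ft_finite C).
have [N _] := pg_nakayama PG; have [S _] := nakayama_tensor_exists N.
split.
  split; last exact: spherical_trace.
  by move=> [t [tM t0]]; exact: (trace_spherical PG S tM t0).
move=> _; split=> [t t' | t]; first exact: (trace_unique PG S).
exact: (trace_nondegenerate PG S).
Qed.
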